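(* Let $\epsilon=(\epsilon_y)_{y\in\mathbb Z}$ be an orientation sequence satisfying the standing assumptions below, with joint law $\nu$. Then for $\nu$-almost every realization of $\epsilon$, the simple random walk $(M_n)_{n\ge 0}$ on the FKG-horizontally oriented lattice $\mathbb L^\epsilon$ is transient.
   Context: Standing assumptions on the orientations. $(\epsilon_y)_{y\in\mathbb Z}$ is a stationary sequence of $\{-1,+1\}$-valued random variables with $\mathbb P[\epsilon_0=+1]=\mathbb P[\epsilon_0=-1]=\tfrac12$, such that: (i) they are associated: for every finite collection $(\epsilon_{y_1},\dots,\epsilon_{y_k})$ and all coordinatewise nondecreasing functions $f,g:\{-1,+1\}^k\to\mathbb R$, $\mathrm{Cov}\big(f(\epsilon_{y_1},\dots,\epsilon_{y_k}),g(\epsilon_{y_1},\dots,\epsilon_{y_k})\big)\ge 0$; (ii) summable power-law decay of correlations: there is $\alpha>1$ with $\mathbb E[\epsilon_0\epsilon_y]=O(|y|^{-\alpha})$ as $|y|\to\infty$. The FKG-horizontally oriented lattice $\mathbb L^\epsilon$ is the directed graph with vertex set $\mathbb Z^2$ in which $(u,v)$, $u=(u_1,u_2)$, $v=(v_1,v_2)$, is a directed edge iff either $v_1=u_1$ and $v_2=u_2\pm1$, or $v_2=u_2$ and $v_1=u_1+\epsilon_{u_2}$. Thus every vertex has exactly three outgoing edges. For a fixed realization of $\epsilon$, the simple random walk $(M_n)_{n\ge0}$ on $\mathbb L^\epsilon$ is the Markov chain on $\mathbb Z^2$ started at $(0,0)$ that moves from $u$ to each of its three out-neighbours with probability $1/3$.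 *)

(* Defs.v *)
From HB Require Import structures.
From mathcomp Require Import all_boot all_order all_algebra.
From mathcomp Require Import all_classical all_reals all_analysis.
Set Implicit Arguments. Unset Strict Implicit. Unset Printing Implicit Defensive.
Import Order.TTheory GRing.Theory Num.Theory.
Local Open Scope classical_set_scope.
Local Open Scope ring_scope.

Definition sgnb (b : bool) : int := if b then 1 else -1.

Section Orient.
Context {d : measure_display} {T : measurableType d} {R : realType}.
Variable P : probability T R.
Variable eps : int -> T -> bool.

Definition cyl_prob (k : nat) (ys : 'I_k -> int) (x : {ffun 'I_k -> bool}) : R :=
  fine (P [set w | forall i : 'I_k, eps (ys i) w = x i]).

Definition expect_fd (k : nat) (ys : 'I_k -> int) (h : {ffun 'I_k -> bool} -> R) : R :=
  \sum_(x : {ffun 'I_k -> bool}) h x * cyl_prob ys x.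

Definition cov_fd (k : nat) (ys : 'I_k -> int) (f g : {ffun 'I_k -> bool} -> R) : R :=
  expect_fd ys (fun x => f x * g x) - expect_fd ys f * expect_fd ys g.

Definition coord_nondecr (k : nat) (f : {ffun 'I_k -> bool} -> R) : Prop :=
  forall x x' : {ffun 'I_k -> bool}, (forall i, x i ==> x' i) -> f x <= f x'.

Definition measurable_orient : Prop :=
  forall y : int, measurable [set w | eps y w].

Definition stationary_orient : Prop :=
  forall (k : nat) (ys : 'I_k -> int) (s : int) (x : {ffun 'I_k -> bool}),
    cyl_prob (fun i => ys i + s) x = cyl_prob ys x.

Definition symmetric_marginal : Prop :=
  P [set w | eps 0 w] = (2%:R^-1)%:E.

Definition associated : Prop :=
  forall (k : nat) (ys : 'I_k -> int) (f g : {ffun 'I_k -> bool} -> R),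
    coord_nondecr f -> coord_nondecr g -> 0 <= cov_fd ys f g.

Definition corr (y : int) : R :=
  expect_fd (fun i : 'I_2 => if val i == 0%N then 0 else y)
            (fun x => (sgnb (x ord0) * sgnb (x ord_max))%:~R).

Definition summable_power_decay : Prop :=
  exists alpha : R, 1 < alpha /\
    exists C : R, exists Y : nat, forall y : int, (Y <= `|y|)%N ->
      `|corr y| <= C * (`|y|%:R `^ (- alpha)).

End Orient.

Definition out_nbrs (e : int -> bool) (u : int * int) : seq (int * int) :=
  [:: (u.1, u.2 + 1); (u.1, u.2 - 1); (u.1 + sgnb (e u.2), u.2)].

(* first_hit e n u = probability that the simple random walk on L^e started
   at u is at (0,0) at time n and not at (0,0) at times 1, ..., n-1
   (n >= 1; first_hit e 0 u = 0). *)
Fixpoint first_hit {R : realType} (e : int -> bool) (n : nat) (u : int * int) : R :=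
  match n with
  | 0%N => 0
  | n'.+1 => 3%:R^-1 * \sum_(w <- out_nbrs e u)
       (if w == (0, 0) then (if n' == 0%N then 1 else 0) else first_hit e n' w)
  end.

(* Transience of the simple random walk (M_n) on L^e started at (0,0):
   the probability of ever returning to (0,0) is < 1. *)
Definition srw_transient (R : realType) (e : int -> bool) : Prop :=
  (\sum_(0 <= n <oo) ((first_hit e n (0, 0) : R)%:E) < 1)%E.

(* Main.v *)
(** Horizontal translation invariance turns the Green function of the walk into
    an average over frequencies [theta] of the solutions [u] of the
    one-dimensional equation [- Delta u + (1 - cos theta) u -+ i sin theta eps u = s delta_0],
    where [s] is three times the escape probability; everything is done on a
    large finite cylinder, and the real and imaginary parts of [u] are [hit_cos]
    and [hit_sin]. The energy identity makes [u] nearly constant over a long range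
    of heights unless [u 0] is small. Cut a segment of length about [theta ^ (- 10/11)]
    into blocks of length [l], about [theta ^ (- 2/11)], and test the equation
    against a tent function on each block, weighted by the corresponding tent
    average [block_sum] of [eps]: if the sum of the squares of these averages has
    the order of magnitude of its mean, then [u 0 = O (s theta ^ (- 10/11))], which
    is integrable at [theta = 0]. As the average over [theta] of [u 0] is 1, this
    bounds [s] from below, uniformly in the size of the cylinder.

    Association enters twice: correlations are nonnegative, which bounds below the
    mean of the sum of squares [V]; and if [U] is the sum of the block averages,
    [2 l^2 U + V] and [2 l^2 U - V] are both nondecreasing functions of [eps], so
    that [Var V <= 4 l^4 Var U]. Chebyshev's inequality at the dyadic scales
    [theta ~ 2 ^ (- 11 p)] and the Borel-Cantelli lemma conclude. *)
Require Import Defs.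
From HB Require Import structures.
From mathcomp Require Import all_boot all_order all_algebra.
From mathcomp Require Import all_classical all_reals all_analysis.
From mathcomp Require Import zify ring lra.
Import Order.TTheory GRing.Theory Num.Theory.
Import numFieldNormedType.Exports.
Local Open Scope classical_set_scope.
Local Open Scope ring_scope.

(** * Finite sums *)

Section FiniteSums.
Context {R : realFieldType}.
Implicit Types (f g u v : nat -> R) (n m i j : nat).

(** Lagrange's identity: the double sum of [(f i * g j - f j * g i) ^+ 2] is twice the gap between
    the two sides. *)
Lemma cauchy_schwarz_sum {I : Type} (s : seq I) (f g : I -> R) :
  (\sum_(i <- s) f i * g i) ^+ 2 <= (\sum_(i <- s) f i ^+ 2) * (\sum_(i <- s) g i ^+ 2).
Proof.
have H : 0 <= \sum_(i <- s) \sum_(j <- s) (f i * g j - f j * g i) ^+ 2.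
  by apply: sumr_ge0 => i _; apply: sumr_ge0 => j _; exact: sqr_ge0.
have E : \sum_(i <- s) \sum_(j <- s) (f i * g j - f j * g i) ^+ 2 =
    2 * ((\sum_(i <- s) f i ^+ 2) * (\sum_(i <- s) g i ^+ 2)
         - (\sum_(i <- s) f i * g i) ^+ 2).
  under eq_bigr => i _.
    under eq_bigr => j _.
      have -> : (f i * g j - f j * g i) ^+ 2 = f i ^+ 2 * g j ^+ 2
         + (g i ^+ 2 * f j ^+ 2 + (- 2 * (f i * g i)) * (f j * g j)) by ring.
      over.
    rewrite !big_split /= -!mulr_sumr.
    over.
  by rewrite !big_split /= -!mulr_suml -mulr_sumr; ring.
rewrite E in H; lra.
Qed.

Lemma sum_nat_blocks (N l : nat) f :
  \sum_(0 <= i < N * l) f i = \sum_(0 <= j < N) \sum_(0 <= r < l) f (j * l + r)%N.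
Proof.
elim: N => [|N IH]; first by rewrite mul0n !big_geq.
rewrite big_nat_recr//= -IH mulSn addnC (big_cat_nat (n := N * l)) ?leq_addr//=.
congr (_ + _); rewrite -{1}[(N * l)%N]add0n big_addn addKn.
by apply: eq_bigr => i _; rewrite addnC.
Qed.

Lemma summation_by_parts n f g : (0 < n)%N -> f 0%N = 0 -> f n = 0 ->
  \sum_(1 <= i < n) f i * (2 * g i - g i.+1 - g i.-1) =
  \sum_(0 <= i < n) (f i.+1 - f i) * (g i.+1 - g i).
Proof.
move=> n0 f0 fn.
(* The induction needs a free upper end, which adds the boundary term [f k * (g k - g k.-1)]; it
   vanishes at [n]. *)
suff H k : (0 < k)%N -> \sum_(0 <= i < k) (f i.+1 - f i) * (g i.+1 - g i) =
  \sum_(1 <= i < k) f i * (2 * g i - g i.+1 - g i.-1) + f k * (g k - g k.-1).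
  by rewrite H// fn mul0r addr0.
elim: k => // -[|k] IH _; first by rewrite big_nat1 big_geq//= f0; ring.
by rewrite big_nat_recr//= IH// [in RHS]big_nat_recr//=; ring.
Qed.

(** Cauchy-Schwarz on the telescoping sum of increments: a function of small energy is nearly
    constant over long ranges. *)
Lemma sqr_increment_le n u i r : (i + r <= n)%N ->
  (u (i + r)%N - u i) ^+ 2 <= r%:R * \sum_(0 <= k < n) (u k.+1 - u k) ^+ 2.
Proof.
move=> irn.
have -> : u (i + r)%N - u i = \sum_(i <= k < i + r) 1 * (u k.+1 - u k).
  by under eq_bigr do rewrite mul1r; rewrite telescope_sumr// leq_addr.
apply: (le_trans (cauchy_schwarz_sum _ _ _)).
rewrite expr1n big_const_nat iter_addr_0 addKn ler_wpM2l ?ler0n//.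
have le_i : (i <= i + r)%N by exact: leq_addr.
rewrite [leRHS](big_cat_nat (leq0n (i + r)%N) irn)/= (big_cat_nat (leq0n i) le_i)/=.
have P a b : 0 <= \sum_(a <= k < b) (u k.+1 - u k) ^+ 2.
  by apply: sumr_ge0 => ? _; exact: sqr_ge0.
have := P 0%N i; have := P (i + r)%N n; lra.
Qed.

Lemma sum_translate_le n z k f : (forall i, 0 <= f i) -> (z + k <= n)%N ->
  \sum_(0 <= i < k) f (z + i)%N <= \sum_(0 <= i < n) f i.
Proof.
move=> f0 zkn; have P i j : 0 <= \sum_(i <= h < j) f h by apply: sumr_ge0.
have -> : \sum_(0 <= i < k) f (z + i)%N = \sum_(z <= i < z + k) f i.
  have := @big_addn R 0 +%R 0 (z + k) z xpredT f; rewrite add0n addKn => ->.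
  by apply: eq_bigr => i _; rewrite addnC.
have zk : (z <= z + k)%N by exact: leq_addr.
rewrite [leRHS](big_cat_nat (leq0n (z + k)%N) zkn)/= (big_cat_nat (leq0n z) zk)/=.
have := P 0%N z; have := P (z + k)%N n; lra.
Qed.

(** Each distance occurs at most twice, once on either side of [i]. *)
Lemma sum_dist_le n (beta : nat -> R) i : (forall k, 0 <= beta k) -> (i < n)%N ->
  \sum_(0 <= j < n) beta `|(i : int) - j|%N <= 2 * \sum_(0 <= k < n) beta k.
Proof.
move=> b0 ltin.
have P a b : 0 <= \sum_(a <= k < b) beta k by apply: sumr_ge0.
rewrite (big_cat_nat (n := i.+1))//=.
have -> : \sum_(0 <= j < i.+1) beta `|(i : int) - j|%N = \sum_(0 <= k < i.+1) beta k.
  rewrite big_nat_rev/=; apply: eq_big_nat => k /andP[_ ki]; congr beta; lia.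
have -> : \sum_(i.+1 <= j < n) beta `|(i : int) - j|%N = \sum_(1 <= k < n - i) beta k.
  rewrite -{1}[i.+1]add1n big_addn; apply: eq_big_nat => k /andP[_ ki]; congr beta; lia.
have H1 : \sum_(0 <= k < i.+1) beta k <= \sum_(0 <= k < n) beta k.
  by rewrite [leRHS](big_cat_nat (n := i.+1))//= lerDl.
have H2 : \sum_(1 <= k < n - i) beta k <= \sum_(0 <= k < n) beta k.
  rewrite [leRHS](big_cat_nat (n := (n - i)%N))//= ?leq_subr//.
  rewrite [X in _ <= X + _](big_cat_nat (n := 1%N))//= ?subn_gt0//.
  by rewrite addrAC lerDr addr_ge0.
lra.
Qed.

End FiniteSums.

(** * The test function argument in one dimension *)

(** Piecewise linear bump on a block of length [l]; it vanishes at both ends, so multiples of it on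
    consecutive blocks glue together. *)
Definition tent {R : realType} (l r : nat) : R := (minn r (l - r))%:R.

Definition orient {R : realType} (e : int -> bool) (y : int) : R := (sgnb (e y))%:~R.

Definition block_sum {R : realType} (e : int -> bool) (l j : nat) : R :=
  \sum_(0 <= r < l) orient e (j * l + r)%N * tent l r.

Definition block_energy {R : realType} (e : int -> bool) (N l : nat) : R :=
  \sum_(0 <= j < N) block_sum e l j ^+ 2.

Section Segment.
Context {R : realType}.
Implicit Types (e : int -> bool) (l r N : nat) (a b : nat -> R).

Lemma tent0 l : tent l 0 = 0 :> R.
Proof. by rewrite /tent min0n. Qed.

Lemma tent_end l : tent l l = 0 :> R.
Proof. by rewrite /tent subnn minn0. Qed.

Lemma tent_ge0 l r : 0 <= tent l r :> R.
Proof. exact: ler0n. Qed.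

Lemma tent_le l r : tent l r <= l%:R :> R.
Proof. by rewrite ler_nat; lia. Qed.

Lemma tent_sqr_le l r : tent l r ^+ 2 <= l%:R ^+ 2 :> R.
Proof. by rewrite lerXn2r ?nnegrE ?ler0n// tent_le. Qed.

Lemma tent_step l r : (r < l)%N -> (tent l r.+1 - tent l r) ^+ 2 <= 1 :> R.
Proof.
move=> rl; rewrite /tent.
have [H|[H|H]] : minn r.+1 (l - r.+1) = minn r (l - r) \/
    minn r.+1 (l - r.+1) = (minn r (l - r)).+1 \/
    minn r (l - r) = (minn r.+1 (l - r.+1)).+1 by lia.
- by rewrite H subrr expr0n/=.
- by rewrite H -natr1 addrC addKr expr1n.
- by rewrite H -natr1 opprD addrA subrr add0r sqrrN expr1n.
Qed.

Lemma orient_sqr e y : orient e y ^+ 2 = 1 :> R.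
Proof. by rewrite /orient /sgnb; case: (e y); rewrite ?rmorphN1 ?sqrrN expr1n. Qed.

(** Cauchy-Schwarz for a gradient term plus [m] times a mass term; the cross term is handled by the
    arithmetic-geometric inequality. *)
Lemma sqr_add_weighted_le {m P Q A B C D : R} :
  0 <= m -> 0 <= A -> 0 <= B -> 0 <= C -> 0 <= D ->
  P ^+ 2 <= A * C -> Q ^+ 2 <= B * D ->
  (P + m * Q) ^+ 2 <= (A + m * B) * (C + m * D).
Proof.
move=> m0 A0 B0 C0 D0 HP HQ.
have H : 2 * (P * Q) <= A * D + B * C.
  apply: le_trans (ler_norm _) _.
  rewrite -(@ler_pXn2r _ 2)// ?nnegrE ?addr_ge0 ?mulr_ge0//.
  rewrite real_normK ?num_real//.
  have H1 : P ^+ 2 * Q ^+ 2 <= (A * C) * (B * D).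
    by apply: ler_pM => //; exact: sqr_ge0.
  have := sqr_ge0 (A * D - B * C); nra.
have : m * (2 * (P * Q)) <= m * (A * D + B * C) by exact: ler_wpM2l.
have : m * m * Q ^+ 2 <= m * m * (B * D) by rewrite ler_wpM2l// mulr_ge0.
nra.
Qed.

(* Testing the sourceless equation for [b] against the piecewise linear function
   [phi], equal to [block_sum e l j * tent l] on the [j]-th block, shows that
   [sum e phi a] is small, whereas it would be [a 0 * block_energy] if [a] were
   constant. *)
Lemma segment_bound e N l a b (m sigma E : R) :
  (0 < l)%N -> 0 <= m -> m * l%:R ^+ 2 <= 1 ->
  (forall i, (0 < i < N * l)%N ->
     2 * b i - b i.+1 - b i.-1 + m * b i = - sigma * (orient e i * a i)) ->
  \sum_(0 <= i < N * l) (a i.+1 - a i) ^+ 2 <= E ->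
  \sum_(0 <= i < N * l) (b i.+1 - b i) ^+ 2 + m * \sum_(0 <= i < N * l) b i ^+ 2 <= E ->
  0 < block_energy e N l :> R ->
  a 0%N ^+ 2 * block_energy e N l * sigma ^+ 2 <=
  3 * E * (2 * l%:R + sigma ^+ 2 * (N%:R * l%:R ^+ 5 + block_energy e N l * (N * l)%:R)).
Proof.
move=> l0 m0 ml eqb Ea Eb; set T := block_energy e N l => T0.
pose W j : R := block_sum e l j.
pose phi i : R := W (i %/ l)%N * tent l (i %% l)%N.
have N0 : (0 < N)%N.
  by rewrite lt0n; apply/eqP => N0; move: T0; rewrite /T /block_energy N0 big_geq// ltxx.
have E0 : 0 <= E by apply: le_trans Ea; apply: sumr_ge0 => ? _; exact: sqr_ge0.
have phiE j r : (r < l)%N -> phi (j * l + r)%N = W j * tent l r.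
  by move=> rl; rewrite /phi divnMDl// divn_small// addn0 modnMDl modn_small.
have phi0 : phi 0%N = 0 by rewrite /phi mod0n tent0 mulr0.
have phiL : phi (N * l)%N = 0 by rewrite /phi modnMl tent0 mulr0.
have phiS j r : (r < l)%N -> phi (j * l + r).+1 = W j * tent l r.+1.
  move=> rl; rewrite -addnS; case: (ltngtP r.+1 l) rl => // [rl _|rl _]; first exact: phiE.
  by rewrite rl tent_end -mulSnr /phi modnMl tent0 !mulr0.
have gradphi : \sum_(0 <= i < N * l) (phi i.+1 - phi i) ^+ 2 <= T * l%:R.
  rewrite sum_nat_blocks /T /block_energy mulr_suml; apply: ler_sum => j _.
  have -> : block_sum e l j ^+ 2 * l%:R = \sum_(0 <= r < l) W j ^+ 2.
    by rewrite big_const_nat iter_addr_0 subn0 -[RHS]mulr_natr.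
  apply: ler_sum_nat => r /andP[_ rl].
  by rewrite phiE// phiS// -mulrBr exprMn ler_piMr ?sqr_ge0// tent_step.
have normphi : \sum_(0 <= i < N * l) phi i ^+ 2 <= T * l%:R * l%:R ^+ 2.
  rewrite sum_nat_blocks /T /block_energy -mulrA mulr_suml; apply: ler_sum => j _.
  have -> : block_sum e l j ^+ 2 * (l%:R * l%:R ^+ 2) = \sum_(0 <= r < l) W j ^+ 2 * l%:R ^+ 2.
    by rewrite big_const_nat iter_addr_0 subn0 -[RHS]mulr_natr /W; ring.
  apply: ler_sum_nat => r /andP[_ rl].
  by rewrite phiE// exprMn ler_wpM2l ?sqr_ge0// tent_sqr_le.
pose X := \sum_(0 <= i < N * l) phi i * (orient e i * a i).
have NL0 : (0 < N * l)%N by rewrite muln_gt0 N0.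
have drop0 (g : nat -> R) : \sum_(0 <= i < N * l) phi i * g i = \sum_(1 <= i < N * l) phi i * g i.
  by rewrite big_ltn// phi0 mul0r add0r.
(* Weak form of the equation: [phi] vanishes at both ends of the segment, so summation by parts
   leaves no boundary term. *)
have weak : \sum_(0 <= i < N * l) (phi i.+1 - phi i) * (b i.+1 - b i)
    + m * \sum_(0 <= i < N * l) phi i * b i = - sigma * X.
  rewrite -summation_by_parts// /X !drop0 !mulr_sumr -big_split/=.
  apply: eq_big_nat => i iL; rewrite [RHS]mulrCA -eqb//; ring.
(* Since [m * l ^ 2 <= 1], the mass of [phi] costs no more than its gradient, whence the factor
   2. *)
have HX : (sigma * X) ^+ 2 <= (2 * l%:R * T) * E.
  rewrite -sqrrN -mulNr -weak.
  have S0 (f : nat -> R) : 0 <= \sum_(0 <= i < N * l) f i ^+ 2.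
    by apply: sumr_ge0 => ? _; exact: sqr_ge0.
  have := sqr_add_weighted_le m0 (S0 (fun i => phi i.+1 - phi i)) (S0 phi)
    (S0 (fun i => b i.+1 - b i)) (S0 b) (cauchy_schwarz_sum _ _ _) (cauchy_schwarz_sum _ _ _).
  move=> /le_trans; apply.
  apply: ler_pM => //; try by apply: addr_ge0 => //; apply: mulr_ge0.
  have : m * \sum_(0 <= i < N * l) phi i ^+ 2 <= T * l%:R * (m * l%:R ^+ 2).
    by rewrite mulrCA ler_wpM2l.
  have : T * l%:R * (m * l%:R ^+ 2) <= T * l%:R by rewrite ler_piMr// mulr_ge0// ltW.
  lra.
pose V j := \sum_(0 <= r < l) (orient e (j * l + r)%N * tent l r) * (a (j * l + r)%N - a (j * l)%N).
have HV j : (j < N)%N -> V j ^+ 2 <= l%:R ^+ 5 * E.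
  move=> jN; apply: (le_trans (cauchy_schwarz_sum _ _ _)).
  have -> : l%:R ^+ 5 * E = (l%:R * l%:R ^+ 2) * (l%:R * (l%:R * E)) by ring.
  have cst (c : R) : l%:R * c = \sum_(0 <= r < l) c.
    by rewrite big_const_nat iter_addr_0 subn0 -[RHS]mulr_natl.
  apply: ler_pM; try by apply: sumr_ge0 => ? _; exact: sqr_ge0.
    rewrite cst; apply: ler_sum => r _.
    by rewrite exprMn orient_sqr mul1r tent_sqr_le.
  rewrite cst; apply: ler_sum_nat => r /andP[_ rl].
  have H : (j * l + r <= N * l)%N by nia.
  apply: (le_trans (sqr_increment_le _ a _ _ H)).
  apply: ler_pM => //; first by apply: sumr_ge0 => ? _; exact: sqr_ge0.
  by rewrite ler_nat ltnW.
(* Errors made in freezing [a]: [Y2] from replacing it by its value at the start of each block, [Y3]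
   from replacing these values by [a 0]. *)
pose Y2 := \sum_(0 <= j < N) W j * V j.
pose Y3 := \sum_(0 <= j < N) W j * (W j * (a (j * l)%N - a 0%N)).
have sum_cst (c : R) : N%:R * c = \sum_(0 <= j < N) c.
  by rewrite big_const_nat iter_addr_0 subn0 -[RHS]mulr_natl.
have HY2 : Y2 ^+ 2 <= T * (N%:R * (l%:R ^+ 5 * E)).
  apply: (le_trans (cauchy_schwarz_sum _ _ _)).
  apply: ler_wpM2l; first exact: ltW.
  rewrite sum_cst; apply: ler_sum_nat => j /andP[_ jN]; exact: HV.
have HY3 : Y3 ^+ 2 <= T * (T * ((N * l)%:R * E)).
  apply: (le_trans (cauchy_schwarz_sum _ _ _)).
  apply: ler_wpM2l; first exact: ltW.
  rewrite /T /block_energy mulr_suml.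
  apply: ler_sum_nat => j /andP[_ jN].
  rewrite exprMn ler_wpM2l ?sqr_ge0//.
  have H : (0 + j * l <= N * l)%N by nia.
  apply: (le_trans (sqr_increment_le _ a _ _ H)).
  apply: ler_pM => //; first by apply: sumr_ge0 => ? _; exact: sqr_ge0.
  by rewrite ler_nat; nia.
have XE : X = a 0%N * T + Y2 + Y3.
  rewrite /X sum_nat_blocks /Y2 /Y3 /T /block_energy mulr_sumr -!big_split/=.
  apply: eq_bigr => j _.
  transitivity (\sum_(0 <= r < l)
    (W j * ((orient e (j * l + r)%N * tent l r) * (a (j * l + r)%N - a (j * l)%N))
     + (orient e (j * l + r)%N * tent l r) * (W j * a (j * l)%N))).
    by apply: eq_big_nat => r /andP[_ rl]; rewrite phiE//; ring.
  rewrite big_split/= -mulr_sumr -mulr_suml -/(V j) -/(block_sum e l j) -/(W j); ring.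
have key : (sigma * (a 0%N * T)) ^+ 2 <=
    3 * ((sigma * X) ^+ 2 + sigma ^+ 2 * Y2 ^+ 2 + sigma ^+ 2 * Y3 ^+ 2).
  have -> : a 0%N * T = X - Y2 - Y3 by rewrite XE; ring.
  rewrite -!exprMn !mulrBr.
  have := sqr_ge0 (sigma * X + sigma * Y2); have := sqr_ge0 (sigma * X + sigma * Y3).
  have := sqr_ge0 (sigma * Y2 - sigma * Y3); nra.
have H2 : sigma ^+ 2 * Y2 ^+ 2 <= sigma ^+ 2 * (T * (N%:R * (l%:R ^+ 5 * E))).
  by rewrite ler_wpM2l ?sqr_ge0.
have H3 : sigma ^+ 2 * Y3 ^+ 2 <= sigma ^+ 2 * (T * (T * ((N * l)%:R * E))).
  by rewrite ler_wpM2l ?sqr_ge0.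
(* The three bounds share a factor [T], hence the multiplication by [T] before comparing. *)
rewrite -(ler_pM2l T0).
have -> : T * (a 0%N ^+ 2 * T * sigma ^+ 2) = (sigma * (a 0%N * T)) ^+ 2 by ring.
apply: (le_trans key).
have -> : T * (3 * E * (2 * l%:R + sigma ^+ 2 * (N%:R * l%:R ^+ 5 + T * (N * l)%:R))) =
  3 * ((2 * l%:R * T) * E + sigma ^+ 2 * (T * (N%:R * (l%:R ^+ 5 * E)))
     + sigma ^+ 2 * (T * (T * ((N * l)%:R * E)))) by ring.
lra.
Qed.

End Segment.

(** * Hitting probabilities on a cylinder *)

Section Cylinder.
Context {R : realType} (e : int -> bool) (M K : nat).
Hypotheses (M0 : (0 < M)%N) (K0 : (0 < K)%N).
Implicit Types (u : int * int) (n : nat).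

Definition on_target (u : int * int) : bool := (M %| u.1)%Z && (u.2 == 0).

(* Probability that the walk, projected to the cylinder (Z/M) x Z and killed at
   height K, visits the projection of the origin by time [n]. *)
Fixpoint hit_before (n : nat) (u : int * int) : R :=
  if on_target u then 1 else
  if n is n'.+1 then
    if (K <= `|u.2|)%N then 0 else 3%:R^-1 * \sum_(w <- out_nbrs e u) hit_before n' w
  else 0.

Definition hit (u : int * int) : R := limn (hit_before ^~ u).

(** Failure of [hit] to be harmonic at the target, where it equals 1: this is the strength of the
    source in the Green equation. *)
Definition defect : R := 3 - \sum_(w <- out_nbrs e (0, 0)) hit w.

Lemma sum_out_nbrs (f : int * int -> R) u : \sum_(w <- out_nbrs e u) f w =
  f (u.1, u.2 + 1) + f (u.1, u.2 - 1) + f (u.1 + sgnb (e u.2), u.2).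
Proof. by rewrite /out_nbrs !big_cons big_nil addr0 addrA. Qed.

Lemma hit_beforeS n u : hit_before n.+1 u =
  if on_target u then 1 else
  if (K <= `|u.2|)%N then 0 else 3%:R^-1 * \sum_(w <- out_nbrs e u) hit_before n w.
Proof. by []. Qed.

Lemma hit_before_bounds n u : 0 <= hit_before n u <= 1.
Proof.
elim: n u => [|n IH] u /=; case: ifP => _; rewrite ?ler01 ?lexx//.
case: ifP => _; rewrite ?ler01 ?lexx// sum_out_nbrs.
have := IH (u.1, u.2 + 1); have := IH (u.1, u.2 - 1).
have := IH (u.1 + sgnb (e u.2), u.2); lra.
Qed.

Lemma hit_before_nondecreasing u : nondecreasing_seq (hit_before ^~ u).
Proof.
apply/nondecreasing_seqP => n; elim: n u => [|n IH] u.
  have /andP[H _] := hit_before_bounds 1 u.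
  by rewrite [leLHS]/=; case tu: (on_target u) => //; rewrite /= tu.
rewrite !hit_beforeS; case: ifP => // _; case: ifP => // _; rewrite !sum_out_nbrs.
have := IH (u.1, u.2 + 1); have := IH (u.1, u.2 - 1).
have := IH (u.1 + sgnb (e u.2), u.2); lra.
Qed.

Lemma cvg_hit u : hit_before n u @[n --> \oo] --> hit u.
Proof.
apply: nondecreasing_is_cvgn; first exact: hit_before_nondecreasing.
by exists 1 => _ [n _ <-]; case/andP: (hit_before_bounds n u).
Qed.

Lemma hit_before_le n u : hit_before n u <= hit u.
Proof.
exact: (nondecreasing_cvgn_le (hit_before_nondecreasing u) (cvg_hit u)).
Qed.

Lemma hit_ge0 u : 0 <= hit u.
Proof.
by apply: le_trans (hit_before_le 0 u); case/andP: (hit_before_bounds 0 u).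
Qed.

Lemma hit_le1 u : hit u <= 1.
Proof.
apply: limr_le; first exact: cvg_hit.
by apply: nearW => n; case/andP: (hit_before_bounds n u).
Qed.

Lemma hit_eq_lim (u : int * int) (l : R) : hit_before n.+1 u @[n --> \oo] --> l -> hit u = l.
Proof.
move=> H; apply: (cvg_unique _ _ H) => //.
by have := cvg_hit u; rewrite -cvg_shiftS.
Qed.

Lemma hit_target u : on_target u -> hit u = 1.
Proof. by move=> tu; apply: hit_eq_lim => /=; rewrite tu; exact: cvg_cst. Qed.

Lemma hit_boundary u : (K <= `|u.2|)%N -> hit u = 0.
Proof.
move=> Ku; have tu : on_target u = false.
  by apply: contraTF Ku => /andP[_ /eqP ->]; rewrite absz0 -ltnNge.
by apply: hit_eq_lim => /=; rewrite tu Ku; exact: cvg_cst.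
Qed.

Lemma hit_harmonic u : ~~ on_target u -> (`|u.2| < K)%N ->
  hit u = 3%:R^-1 * \sum_(w <- out_nbrs e u) hit w.
Proof.
move=> /negbTE tu uK; apply: hit_eq_lim => /=; rewrite tu leqNgt uK/=.
under eq_fun do rewrite sum_out_nbrs.
by rewrite sum_out_nbrs; apply: cvgMr; do 2?apply: cvgD; exact: cvg_hit.
Qed.

Lemma on_target_translate u : on_target (u.1 + M, u.2) = on_target u.
Proof. by rewrite /on_target/= rpredDr// dvdzz. Qed.

Lemma hit_translate u : hit (u.1 + M, u.2) = hit u.
Proof.
suff H n : hit_before n (u.1 + M, u.2) = hit_before n u by rewrite /hit; under eq_fun do rewrite H.
elim: n u => [|n IH] u; rewrite /= on_target_translate//.
rewrite !sum_out_nbrs/= -(IH (u.1, u.2 + 1)) -(IH (u.1, u.2 - 1)).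
by rewrite -(IH (u.1 + sgnb (e u.2), u.2))/= [u.1 + M + _]addrAC.
Qed.

Lemma hit_translate_mul (k : int) u : hit (u.1 + k * M, u.2) = hit u.
Proof.
have N (n : nat) v : hit (v.1 + n%:Z * M, v.2) = hit v.
  elim: n v => [|n IH] v; first by rewrite mul0r addr0; case: v.
  have := hit_translate (v.1 + n%:Z * M, v.2); rewrite /= IH => <-.
  by rewrite -addn1 PoszD mulrDl mul1r addrA.
case: k => n; first exact: N.
by rewrite -(N n.+1 (u.1 + Negz n * M, u.2)) /= NegzE mulNr subrK; case: u.
Qed.

Lemma defect_ge0 : 0 <= defect.
Proof.
rewrite /defect sum_out_nbrs /=.
have := hit_le1 (0, 0 + 1); have := hit_le1 (0, 0 - 1).
have := hit_le1 (0 + sgnb (e 0), 0); lra.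
Qed.

(** Off the target this is harmonicity; on it, horizontal periodicity reduces to the origin, where
    the source is [defect] by definition. *)
Lemma hit_eq (x y : int) : (`|y| < K)%N ->
  3 * hit (x, y) = hit (x, y + 1) + hit (x, y - 1) + hit (x + sgnb (e y), y)
    + defect * (on_target (x, y))%:R.
Proof.
move=> yK; have [tu|tu] := boolP (on_target (x, y)); last first.
  by rewrite hit_harmonic// sum_out_nbrs/= mulr0 addr0 mulrA mulfV ?mul1r// pnatr_eq0.
rewrite hit_target// /defect !sum_out_nbrs/=.
move: tu => /andP[/= /dvdzP[k ->] /eqP ->].
have := hit_translate_mul k (0, 0 + 1); have := hit_translate_mul k (0, 0 - 1).
have := hit_translate_mul k (0 + sgnb (e 0), 0); rewrite /= addrAC !add0r => -> -> ->; ring.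
Qed.

Lemma first_hit_sum n u : \sum_(0 <= j < n.+2) first_hit e j u =
  3%:R^-1 * \sum_(w <- out_nbrs e u)
     (if w == (0, 0) then 1 else \sum_(0 <= j < n.+1) first_hit e j w) :> R.
Proof.
rewrite big_nat_recl//= add0r -mulr_sumr; congr (_ * _).
rewrite exchange_big/=; apply: eq_bigr => w _; case: ifP => // _.
(* The case [w = (0, 0)]: only the term of index 0 counts, the origin being reached at that very
   step. *)
by rewrite big_nat_recl// big1_seq ?addr0// => -[].
Qed.

Lemma first_hit_sum_le1 n u : \sum_(0 <= j < n.+1) first_hit e j u <= 1 :> R.
Proof.
elim: n u => [|n IH] u; first by rewrite big_nat1 ler01.
pose G w : R := if w == (0, 0) then 1 else \sum_(0 <= j < n.+1) first_hit e j w.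
have H w : G w <= 1 by rewrite /G; case: ifP.
rewrite first_hit_sum (sum_out_nbrs G).
have := H (u.1, u.2 + 1); have := H (u.1, u.2 - 1).
have := H (u.1 + sgnb (e u.2), u.2); lra.
Qed.

(** In [n] steps the walk cannot reach height [K], so killing has no effect, and the origin is one
    of the points projected to the target. *)
Lemma first_hit_step_le n u : (`|u.2|%N + n < K)%N ->
  (if u == (0, 0) then 1 else \sum_(0 <= j < n.+1) first_hit e j u) <= hit_before n u.
Proof.
elim: n u => [|n IH] u uK.
  rewrite big_nat1 /=; case: eqP => [->|_]; first by rewrite /on_target dvdz0 eqxx.
  by case: ifP => _; rewrite ?ler01.
case: eqP => [->|_]; first by rewrite /= /on_target dvdz0 eqxx.
(* At another preimage of the target the right side is already 1, and the left side is a
   probability. *)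
case tu: (on_target u); first by rewrite /= tu; exact: first_hit_sum_le1.
rewrite first_hit_sum /= tu ifF; last lia.
rewrite !sum_out_nbrs ler_wpM2l ?invr_ge0//.
by do 2?apply: lerD; apply: IH; move: uK; case: u {tu} => x y /=; lia.
Qed.

(** The right side is the mean of [hit] over the three neighbours of the origin, all at height at
    most 1. *)
Lemma return_le n : (n.+1 < K)%N ->
  \sum_(0 <= j < n.+2) first_hit e j (0, 0) <= 1 - defect / 3.
Proof.
move=> nK; pose G w : R := if w == (0, 0) then 1 else \sum_(0 <= j < n.+1) first_hit e j w.
rewrite first_hit_sum /defect (sum_out_nbrs G) sum_out_nbrs.
have H w : (`|w.2|%N <= 1)%N -> G w <= hit w.
  by move=> wK; apply: le_trans (hit_before_le n w); apply: first_hit_step_le;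
    apply: leq_ltn_trans nK; rewrite -add1n leq_add2r.
set o := (0, 0) : int * int.
have := H (o.1, o.2 + 1) isT; have := H (o.1, o.2 - 1) isT.
have := H (o.1 + sgnb (e o.2), o.2) isT; lra.
Qed.

End Cylinder.

(** * Upper bounds on the one-dimensional Green function at its source *)

Section GreenBounds.
Context {R : realType} (e : int -> bool) (z n : nat) (a b : nat -> R) (m sigma s : R).
Hypotheses (z0 : (0 < z)%N) (zn : (z < n)%N) (m0 : 0 <= m) (s0 : 0 <= s).
Hypotheses (a0 : a 0%N = 0) (an : a n = 0) (b0 : b 0%N = 0) (bn : b n = 0).
Hypothesis eqa : forall i, (0 < i < n)%N -> 2 * a i - a i.+1 - a i.-1 + m * a i =
  sigma * (orient e (i%:Z - z%:Z) * b i) + s * (i == z)%:R.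
Hypothesis eqb : forall i, (0 < i < n)%N -> 2 * b i - b i.+1 - b i.-1 + m * b i =
  - sigma * (orient e (i%:Z - z%:Z) * a i).

Let sq_ge0 (u : nat -> R) i j : 0 <= \sum_(i <= k < j) u k ^+ 2.
Proof. by apply: sumr_ge0 => ? _; exact: sqr_ge0. Qed.

(** Multiply the first equation by [a], the second by [b] and add: the coupling terms in [sigma]
    cancel and only the source remains. *)
Lemma energy_identity :
  \sum_(0 <= i < n) (a i.+1 - a i) ^+ 2 + \sum_(0 <= i < n) (b i.+1 - b i) ^+ 2
  + m * (\sum_(0 <= i < n) a i ^+ 2 + \sum_(0 <= i < n) b i ^+ 2) = s * a z.
Proof.
have n0 : (0 < n)%N by lia.
have Sq (u : nat -> R) : \sum_(0 <= i < n) u i ^+ 2 = \sum_(0 <= i < n) u i * u i.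
  by apply: eq_bigr => i _; rewrite expr2.
rewrite 2!(Sq (fun i => _ - _)) -!summation_by_parts//.
rewrite (big_ltn (F := fun i => a i ^+ 2))// (big_ltn (F := fun i => b i ^+ 2))//.
rewrite a0 b0 !expr0n/= !add0r -!big_split mulr_sumr -big_split/=.
transitivity (\sum_(1 <= i < n) s * a z * (i == z)%:R).
  apply: eq_big_nat => i iL; have := eqa i iL; have := eqb i iL.
  case: (i =P z) => [->|_] /= Hb Ha.
    transitivity (a z * (2 * a z - a z.+1 - a z.-1 + m * a z)
      + b z * (2 * b z - b z.+1 - b z.-1 + m * b z)); first by ring.
    by rewrite Ha Hb; ring.
  transitivity (a i * (2 * a i - a i.+1 - a i.-1 + m * a i)
    + b i * (2 * b i - b i.+1 - b i.-1 + m * b i)); first by ring.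
  by rewrite Ha Hb; ring.
rewrite -mulr_sumr (big_cat_nat (n := z))//=; last exact: ltnW.
rewrite (big_ltn zn) eqxx !big1_seq ?addr0 ?add0r ?mulr1// => i;
  rewrite mem_index_iota => /andP[_ iz]; rewrite (_ : (i == z) = false)//; lia.
Qed.

(** The energy is linear in [a z] and bounds a multiple of its square, so one factor [a z] can be
    divided out. *)
Let le_of_sqr_le (c d : R) : 0 < c -> 0 <= d -> c * a z ^+ 2 <= s * a z * d -> a z <= s * (d / c).
Proof.
move=> c0 d0; have [az0 _|az0] := lerP (a z) 0.
  by apply: (le_trans az0); rewrite !mulr_ge0// invr_ge0 ltW.
by rewrite mulrA ler_pdivlMr// expr2 mulrA [leRHS]mulrAC ler_pM2r// mulrC.
Qed.

(** From the end, where [a] is 0, to [z] there are [z] steps, of total energy at most [s * a z]. *)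
Lemma green_height_bound : a z <= s * z%:R.
Proof.
rewrite -[z%:R]divr1; apply: le_of_sqr_le => //; rewrite mul1r.
have zn' : (0 + z <= n)%N by lia.
have := sqr_increment_le n a _ _ zn'; rewrite add0n a0 subr0 => /le_trans; apply.
rewrite mulrC ler_wpM2r// -energy_identity.
have := mulr_ge0 m0 (addr_ge0 (sq_ge0 a 0 n) (sq_ge0 b 0 n)).
have := sq_ge0 (fun i => b i.+1 - b i) 0 n; lra.
Qed.

(** Of the energy, only the mass term at [z] is kept. *)
Lemma green_mass_bound : 0 < m -> a z <= s / m.
Proof.
move=> mp; rewrite -[m^-1]mul1r; apply: le_of_sqr_le => //; rewrite mulr1 -energy_identity.
have H : a z ^+ 2 <= \sum_(0 <= i < n) a i ^+ 2.
  rewrite (big_cat_nat (n := z))//=; last exact: ltnW.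
  by rewrite (big_ltn zn) addrCA lerDl addr_ge0// sq_ge0.
have := ler_wpM2l m0 H; have := mulr_ge0 m0 (sq_ge0 b 0%N n).
have := sq_ge0 (fun i => b i.+1 - b i) 0 n; have := sq_ge0 (fun i => a i.+1 - a i) 0 n; lra.
Qed.

(** [segment_bound] on the segment starting at the source, with energy [s * a z]; the richness
    assumption bounds the block energy below. *)
Lemma green_block_bound (N q : nat) (l := (4 * q)%N) : (0 < q)%N -> (0 < N)%N ->
  (z + N * l <= n)%N -> sigma != 0 -> m * l%:R ^+ 2 <= 1 ->
  N%:R * q%:R ^+ 3 <= block_energy e N l :> R ->
  a z <= s * (3 * ((N * l)%:R + 64 * l%:R ^+ 2 + 128 / (N%:R * l%:R ^+ 2 * sigma ^+ 2))).
Proof.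
move=> q0 N0 zNl sg0 ml TN; set T := block_energy e N l in TN *.
have qp : (0 : R) < q%:R by rewrite ltr0n.
have Np : (0 : R) < N%:R by rewrite ltr0n.
have sp : 0 < sigma ^+ 2 by rewrite exprn_even_gt0.
have Tp : 0 < T by apply: lt_le_trans TN; rewrite mulr_gt0// exprn_gt0.
have shift (u : nat -> R) : \sum_(0 <= i < N * l) (u (z + i).+1 - u (z + i)%N) ^+ 2 <=
    \sum_(0 <= i < n) (u i.+1 - u i) ^+ 2.
  by apply: (sum_translate_le n z (N * l) (fun i => (u i.+1 - u i) ^+ 2)) => // i; exact: sqr_ge0.
have shift0 (u : nat -> R) : \sum_(0 <= i < N * l) u (z + i)%N ^+ 2 <= \sum_(0 <= i < n) u i ^+ 2.
  by apply: (sum_translate_le n z (N * l) (fun i => u i ^+ 2)) => // i; exact: sqr_ge0.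
have EI := energy_identity.
have P1 := mulr_ge0 m0 (addr_ge0 (sq_ge0 a 0 n) (sq_ge0 b 0 n)).
have P2 := sq_ge0 (fun i => b i.+1 - b i) 0 n.
have P3 := sq_ge0 (fun i => a i.+1 - a i) 0 n.
have P4 := mulr_ge0 m0 (sq_ge0 a 0%N n).
have H := @segment_bound R e N l (fun i => a (z + i)%N) (fun i => b (z + i)%N) m sigma (s * a z).
have {}H : a (z + 0)%N ^+ 2 * T * sigma ^+ 2 <=
    3 * (s * a z) * (2 * l%:R + sigma ^+ 2 * (N%:R * l%:R ^+ 5 + T * (N * l)%:R)).
  apply: H => //.
  - by rewrite /l muln_gt0.
  - move=> i /andP[i0 iL].
    have Hi : (0 < z + i < n)%N.
      by rewrite addn_gt0 z0; apply: leq_trans zNl; rewrite ltn_add2l.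
    have -> : (i : int) = (z + i)%N%:Z - z%:Z by rewrite PoszD addrAC subrr add0r.
    have -> : (z + i.-1)%N = (z + i).-1 by rewrite -[in RHS](prednK i0) addnS.
    by rewrite -eqb// addnS.
  - by under eq_bigr do rewrite addnS; apply: (le_trans (shift a)); lra.
  - have H1 := shift b; have H2 := ler_wpM2l m0 (shift0 b).
    by under eq_bigr do rewrite addnS; lra.
rewrite addn0 in H.
pose d := 3 * (2 * l%:R + sigma ^+ 2 * (N%:R * l%:R ^+ 5 + T * (N * l)%:R)).
have lp : (0 : R) < l%:R by rewrite ltr0n muln_gt0.
have d0 : 0 <= d.
  have T1 := ltW Tp; rewrite /d.
  apply: mulr_ge0 => //; apply: addr_ge0; first exact: mulr_ge0.
  apply: mulr_ge0; first exact: sqr_ge0.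
  by apply: addr_ge0; apply: mulr_ge0 => //; exact: exprn_ge0.
have {}H : a z <= s * (d / (T * sigma ^+ 2)).
  apply: le_of_sqr_le => //; first exact: mulr_gt0.
  by move: H; rewrite /d; lra.
apply: (le_trans H); apply: ler_wpM2l => //.
have lq : l%:R = 4 * q%:R :> R by rewrite natrM.
(* As [N * q ^ 3 = N * l ^ 3 / 64], the second and third terms are at most [64 * l ^ 2] and
   [128 / (N * l ^ 2 * sigma ^ 2)]. *)
have -> : d / (T * sigma ^+ 2) = 3 * ((N * l)%:R + (N%:R * l%:R ^+ 5) / T + (2 * l%:R) / (T * sigma ^+ 2)).
  by rewrite /d; field; rewrite ?sg0 ?gt_eqF.
rewrite ler_pM2l// -!addrA lerD2l; apply: lerD.
  by rewrite ler_pdivrMr//; apply: (@le_trans _ _ (64 * l%:R ^+ 2 * (N%:R * q%:R ^+ 3)));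
    [rewrite lq; lra | rewrite ler_pM2l// mulr_gt0// exprn_gt0].
rewrite ler_pdivrMr; last exact: mulr_gt0.
apply: (@le_trans _ _ (128 / (N%:R * l%:R ^+ 2 * sigma ^+ 2) * (N%:R * q%:R ^+ 3 * sigma ^+ 2))).
  have -> : 128 / (N%:R * l%:R ^+ 2 * sigma ^+ 2) * (N%:R * q%:R ^+ 3 * sigma ^+ 2) = 2 * l%:R :> R => //.
  by rewrite lq; field; rewrite ?sg0 ?gt_eqF.
apply: ler_wpM2l; last by rewrite ler_pM2r.
apply: divr_ge0 => //; apply: mulr_ge0; last exact: sqr_ge0.
by apply: mulr_ge0; [exact: ltW | exact: sqr_ge0].
Qed.

End GreenBounds.

(** * Fourier transform *)

(** By the mean value theorem [sin x = x * cos c] with [c <= pi / 4]; then [cos (2 c) >= 0] forces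
    [cos c >= 1 / 2]. *)
Lemma sin_bounds {R : realType} (x : R) : 0 < x -> x <= pi / 4 ->
  x / 2 <= sin x /\ sin x <= x.
Proof.
move=> x0 xpi.
have [c cx sE] : exists2 c, c \in `[0, x]%R & sin x - sin 0 = cos c * (x - 0).
  apply: (@MVT_segment R sin cos 0 x (ltW x0)).
  exact/continuous_subspaceT/continuous_sin.
move: sE; rewrite sin0 !subr0 => ->.
have /andP[c0 cx'] : 0 <= c <= x by move: cx; rewrite in_itv.
have pi0 := pi_gt0 R.
have cc : 0 <= cos (c *+ 2) by apply: cos_ge0_pihalf; rewrite -mulr_natr; apply/andP; split; lra.
have c1 := cos_le1 c.
have cp : 0 <= cos c by apply: cos_ge0_pihalf; apply/andP; split; lra.
have c2 : 1 / 2 <= cos c by move: cc; rewrite cos_mulr2n -mulr_natr; nra.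
nra.
Qed.

Section Fourier.
Context {R : realType} (e : int -> bool) (M K : nat).
Hypotheses (M0 : (0 < M)%N) (K0 : (0 < K)%N).
Implicit Types (k n i : nat) (x y : int).

Let s : R := defect e M K.
Let h (u : int * int) : R := hit e M K u.

Definition freq k : R := k%:R * (pi *+ 2 / M%:R).

Definition hit_cos k y : R := \sum_(0 <= t < M) h (t%:Z, y) * cos (freq k * t%:~R).
Definition hit_sin k y : R := \sum_(0 <= t < M) h (t%:Z, y) * sin (freq k * t%:~R).

Lemma sum_periodic_shift (f : int -> R) (b : bool) : (forall x, f (x + M) = f x) ->
  \sum_(0 <= t < M) f (t%:Z + sgnb b) = \sum_(0 <= t < M) f t%:Z.
Proof.
have S (g : int -> R) : (forall x, g (x + M) = g x) ->
    \sum_(0 <= t < M) g (t%:Z + 1) = \sum_(0 <= t < M) g t%:Z.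
  move=> gM; have : \sum_(0 <= t < M.+1) g t%:Z = \sum_(0 <= t < M.+1) g t%:Z by [].
  rewrite [LHS]big_nat_recl// [RHS]big_nat_recr//= -[M%:Z]add0r gM [LHS]addrC => E.
  by rewrite -(addIr _ E); apply: eq_bigr => t _; rewrite -addn1 PoszD.
move=> fM; case: b => /=; first exact: S.
rewrite -(S (fun x => f (x - 1))); first by apply: eq_bigr => t _; rewrite addrK.
by move=> x; rewrite addrAC fM.
Qed.

Lemma freq_period k x : freq k * (x + M)%:~R = freq k * x%:~R + pi *+ 2 *+ k.
Proof.
rewrite intrD mulrDr; congr (_ + _); rewrite /freq -mulrA divfK ?mulr_natl//.
by rewrite pnatr_eq0 -lt0n.
Qed.

Lemma cos_period k x c : cos (freq k * (x + M)%:~R - c) = cos (freq k * x%:~R - c).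
Proof. by rewrite freq_period addrAC periodicn//; exact: cosD2pi. Qed.

Lemma sin_period k x c : sin (freq k * (x + M)%:~R - c) = sin (freq k * x%:~R - c).
Proof. by rewrite freq_period addrAC periodicn//; exact: sinD2pi. Qed.

Lemma trig_orient y (c : R) : cos (orient e y * c) = cos c /\
  sin (orient e y * c) = orient e y * sin c.
Proof.
rewrite /orient /sgnb; case: (e y); first by rewrite !mul1r.
by rewrite rmorphN1 !mulN1r cosN sinN.
Qed.

(** Changing variables over a period turns the horizontal step at height [y] into a phase shift. *)
Lemma sum_shift_phase (g : R -> R) k y :
  (forall x c, g (freq k * (x + M)%:~R - c) = g (freq k * x%:~R - c)) ->
  \sum_(0 <= t < M) h (t%:Z + sgnb (e y), y) * g (freq k * t%:~R) =
  \sum_(0 <= t < M) h (t%:Z, y) * g (freq k * t%:~R - orient e y * freq k).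
Proof.
move=> gM.
rewrite -(sum_periodic_shift (fun x => h (x, y) * g (freq k * x%:~R - orient e y * freq k)) (e y)).
  by apply: eq_bigr => t _; congr (_ * g _); rewrite intrD /orient; ring.
by move=> x; rewrite gM /h (hit_translate e M K (x, y)).
Qed.

Lemma sum_target (g : R -> R) k y : \sum_(0 <= t < M)
  (s * (on_target M (t%:Z, y))%:R) * g (freq k * t%:~R) = s * (y == 0)%:R * g 0.
Proof.
rewrite big_ltn//= mulr0 /on_target/= dvdz0/= big1_seq ?addr0// => t.
rewrite mem_index_iota => /andP[_ /andP[t0 tM]].
have -> : (M %| t%:Z)%Z = false by rewrite dvdzE/= gtnNdvd.
by rewrite mulr0 mul0r.
Qed.

(** Transform of [hit_eq]. In the subtraction formula the cosine of the phase ignores the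
    orientation, while the sine carries its sign and couples the two parts. *)
Lemma hit_cos_eq k y : (`|y| < K)%N -> 3 * hit_cos k y =
  hit_cos k (y + 1) + hit_cos k (y - 1) + cos (freq k) * hit_cos k y
  + sin (freq k) * (orient e y * hit_sin k y) + s * (y == 0)%:R.
Proof.
move=> yK; have := sum_target cos k y; rewrite cos0 mulr1 => <-; rewrite mulr_sumr.
transitivity (\sum_(0 <= t < M) (h (t%:Z, y + 1) * cos (freq k * t%:~R)
   + h (t%:Z, y - 1) * cos (freq k * t%:~R)
   + h (t%:Z + sgnb (e y), y) * cos (freq k * t%:~R)
   + (s * (on_target M (t%:Z, y))%:R) * cos (freq k * t%:~R))).
  by apply: eq_bigr => t _; rewrite mulrA /h /s hit_eq//; ring.
rewrite !big_split/= sum_shift_phase; last exact: cos_period.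
congr (_ + _); rewrite -!addrA; do 2!congr (_ + _).
have [cE sE] := trig_orient y (freq k).
rewrite /hit_sin /hit_cos !mulr_sumr -big_split; apply: eq_bigr => t _ /=.
by rewrite cosB cE sE; ring.
Qed.

Lemma hit_sin_eq k y : (`|y| < K)%N -> 3 * hit_sin k y =
  hit_sin k (y + 1) + hit_sin k (y - 1) + cos (freq k) * hit_sin k y
  - sin (freq k) * (orient e y * hit_cos k y).
Proof.
move=> yK; rewrite -[RHS]addr0; have := sum_target sin k y; rewrite sin0 mulr0 => <-.
rewrite mulr_sumr.
transitivity (\sum_(0 <= t < M) (h (t%:Z, y + 1) * sin (freq k * t%:~R)
   + h (t%:Z, y - 1) * sin (freq k * t%:~R)
   + h (t%:Z + sgnb (e y), y) * sin (freq k * t%:~R)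
   + (s * (on_target M (t%:Z, y))%:R) * sin (freq k * t%:~R))).
  by apply: eq_bigr => t _; rewrite mulrA /h /s hit_eq//; ring.
rewrite !big_split/= sum_shift_phase; last exact: sin_period.
congr (_ + _); rewrite -!addrA; do 2!congr (_ + _).
have [cE sE] := trig_orient y (freq k).
rewrite /hit_sin /hit_cos !mulr_sumr -sumrN -big_split; apply: eq_bigr => t _ /=.
by rewrite sinB cE sE; ring.
Qed.

Lemma hit_cos_boundary k y : (K <= `|y|)%N -> hit_cos k y = 0.
Proof. by move=> yK; apply: big1 => t _; rewrite /h hit_boundary// mul0r. Qed.

Lemma hit_sin_boundary k y : (K <= `|y|)%N -> hit_sin k y = 0.
Proof. by move=> yK; apply: big1 => t _; rewrite /h hit_boundary// mul0r. Qed.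

(* Fejer's kernel [sum_(i, j < n) cos ((i - j) x)] is nonnegative and takes the
   value [n ^+ 2] at [x = 0]. *)
Lemma fejer_bound n (beta : nat -> R) : (0 < n)%N ->
  (forall k, 0 <= beta k) -> (forall k, (k < n)%N -> hit_cos k 0 <= beta k) ->
  n%:R <= 2 * \sum_(0 <= k < n) beta k.
Proof.
move=> n0 beta0 Hbeta.
pose w (t : nat) : R := freq 1 * t%:R.
pose F t : R := \sum_(0 <= i < n) \sum_(0 <= j < n) cos (i%:R * w t - j%:R * w t).
have F0 t : 0 <= F t.
  have -> : F t = (\sum_(0 <= i < n) cos (i%:R * w t)) ^+ 2 + (\sum_(0 <= i < n) sin (i%:R * w t)) ^+ 2.
    rewrite !expr2 !mulr_suml -big_split; apply: eq_bigr => i _.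
    rewrite !mulr_sumr -big_split; apply: eq_bigr => j _ /=; exact: cosB.
  by rewrite addr_ge0// sqr_ge0.
have FE t i j : cos (i%:R * w t - j%:R * w t) = cos (freq `|(i : int) - j|%N * t%:~R).
  have D a b : (a <= b)%N -> freq `|(b : int) - a|%N * t%:~R = b%:R * w t - a%:R * w t.
    by move=> ab; rewrite subzn// absz_nat /freq /w /freq natrB// -pmulrn; ring.
  have [ij|/ltnW ij] := leqP j i; first by rewrite D.
  by rewrite -cosN opprB -D// distnC.
(* All terms are nonnegative; only [t = 0], the target itself, is kept. *)
have n2 : n%:R ^+ 2 <= \sum_(0 <= t < M) h (t%:Z, 0) * F t.
  rewrite (big_ltn M0) /h hit_target ?mul1r; last by rewrite /on_target dvdz0 eqxx.
  have -> : F 0%N = n%:R ^+ 2.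
    rewrite /F /w; under eq_bigr do under eq_bigr do rewrite !mulr0 subrr cos0.
    by rewrite !big_const_nat !iter_addr_0 subn0 -mulrnA -natrX.
  by rewrite lerDl; apply: sumr_ge0 => t _; rewrite mulr_ge0// hit_ge0.
(* Expanding the kernel instead yields values of [hit_cos] at frequencies [|i - j| < n], which
   [beta] controls. *)
have E : \sum_(0 <= t < M) h (t%:Z, 0) * F t =
    \sum_(0 <= i < n) \sum_(0 <= j < n) hit_cos `|(i : int) - j|%N 0.
  under eq_bigr do rewrite mulr_sumr.
  rewrite exchange_big; apply: eq_bigr => i _ /=.
  under eq_bigr do rewrite mulr_sumr.
  rewrite exchange_big; apply: eq_bigr => j _ /=.
  by apply: eq_bigr => t _; rewrite FE.
have np : (0 : R) < n%:R by rewrite ltr0n.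
rewrite -(ler_pM2l np) -expr2; apply: (le_trans n2); rewrite E.
have -> : n%:R * (2 * \sum_(0 <= k < n) beta k) = \sum_(0 <= i < n) (2 * \sum_(0 <= k < n) beta k).
  by rewrite big_const_nat iter_addr_0 subn0 -[RHS]mulr_natl.
apply: ler_sum_nat => i /andP[_ ltin].
apply: le_trans (sum_dist_le n beta i beta0 ltin).
by apply: ler_sum_nat => j /andP[_ jn]; apply: Hbeta; lia.
Qed.

End Fourier.

(** * Transience from rich scales *)

(* With [q = 4 ^ p] and [N = 256 ^ p], half of the lower bound [2 N q ^ 3] on the
   mean of the energy of [N] blocks of length [4 q]. *)
Definition rich_at_scale (R : realType) (e : int -> bool) (p : nat) : Prop :=
  (((2 ^ p) ^ 8)%:R * ((2 ^ p) ^ 2)%:R ^+ 3 : R) <=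
  block_energy e ((2 ^ p) ^ 8) (4 * (2 ^ p) ^ 2).

(** * Powers of [B = 2 ^ p] at the scale where the normalised frequency [x] is about [B ^ -11] *)

Section ScaleArithmetic.
Context {R : realFieldType}.
Implicit Types (B x m sg P : R).

(** For the finitely many scales below the first rich one: the mass bound is at most [32 * B ^ 22],
    absorbed in the constant through [P]. *)
Lemma scale_mass_arith B x m P : 1 <= B -> 0 < x -> 1 <= x * B ^+ 11 ->
  x ^+ 2 / 32 <= m -> B ^+ 22 <= P -> m^-1 <= (2 ^+ 12 + 32 * P) * B ^+ 10.
Proof.
move=> B1 x0 xlo m_lo BP.
have x20 : 0 < x ^+ 2 by rewrite exprn_gt0.
have m0 : 0 < m by apply: lt_le_trans m_lo; rewrite divr_gt0.
have sq_lo : 1 <= x ^+ 2 * B ^+ 22.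
  by have -> : x ^+ 2 * B ^+ 22 = (x * B ^+ 11) ^+ 2; [ring | exact: exprn_ege1].
have B10 : 1 <= B ^+ 10 by exact: exprn_ege1.
have B22 : 1 <= B ^+ 22 by exact: exprn_ege1.
have H1 : m^-1 <= 32 * B ^+ 22.
  rewrite -[m^-1]mul1r ler_pdivrMr//.
  apply: (@le_trans _ _ (32 * B ^+ 22 * (x ^+ 2 / 32))).
    by have -> : 32 * B ^+ 22 * (x ^+ 2 / 32) = x ^+ 2 * B ^+ 22 by field.
  by rewrite ler_wpM2l// mulr_ge0// (le_trans _ B22).
have C0 : (0 : R) <= 2 ^+ 12 by exact: exprn_ge0.
have HC : 32 * B ^+ 22 <= 2 ^+ 12 + 32 * P by clear -BP C0; lra.
apply: (le_trans H1); apply: (le_trans HC); apply: ler_peMr B10.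
by apply: le_trans HC; rewrite mulr_ge0// (le_trans _ B22).
Qed.

(** The mass condition for blocks of length [4 * B ^ 2]. After multiplication by [B ^ 18] the left
    side is at most [2 ^ 26], and [B >= 4] makes the right side at least [2 ^ 36]. *)
Lemma scale_fit_arith B x : 4 <= B -> 0 < x -> x * B ^+ 11 <= 2 ^+ 11 ->
  x ^+ 2 * (4 * B ^+ 2) ^+ 2 <= 1.
Proof.
move=> B4 x0 xhi; have B0 : 0 < B by apply: lt_le_trans B4.
have B18p : 0 < B ^+ 18 by rewrite exprn_gt0.
have B18 : 4 ^+ 18 <= B ^+ 18 by apply: lerXn2r; rewrite ?nnegrE ?(ltW B0).
have xh2 : (x * B ^+ 11) ^+ 2 <= (2 ^+ 11) ^+ 2.
  have u0 : 0 <= x * B ^+ 11 by apply: mulr_ge0; [exact: ltW | exact/exprn_ge0/ltW].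
  by apply: lerXn2r; rewrite ?nnegrE ?u0 ?exprn_ge0.
rewrite -(ler_pM2r B18p) mul1r; apply: le_trans B18.
have -> : x ^+ 2 * (4 * B ^+ 2) ^+ 2 * B ^+ 18 = (x * B ^+ 11) ^+ 2 * 2 ^+ 4 by ring.
apply: (@le_trans _ _ ((2 ^+ 11) ^+ 2 * 2 ^+ 4)); first by rewrite ler_pM2r// exprn_gt0.
have -> : 4 = 2 ^+ 2 :> R by ring.
by rewrite -!exprM -exprD ler_weXn2l// ler1n.
Qed.

(** With [N = B ^ 8] and [l = 4 * B ^ 2], the three terms are at most 4, 1024 and 128 times
    [B ^ 10], and [3 * 1156 <= 2 ^ 12]. *)
Lemma scale_block_arith B x sg P : 1 <= B -> 0 < x -> 1 <= x * B ^+ 11 -> x / 4 <= sg -> 0 <= P ->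
  3 * (B ^+ 8 * (4 * B ^+ 2) + 64 * (4 * B ^+ 2) ^+ 2
       + 128 / (B ^+ 8 * (4 * B ^+ 2) ^+ 2 * sg ^+ 2)) <= (2 ^+ 12 + 32 * P) * B ^+ 10.
Proof.
move=> B1 x0 xlo sg_lo P0; have B0 : 0 < B by apply: lt_le_trans B1.
have sq_lo : 1 <= x ^+ 2 * B ^+ 22.
  by have -> : x ^+ 2 * B ^+ 22 = (x * B ^+ 11) ^+ 2; [ring | exact: exprn_ege1].
have sg0 : 0 < sg by apply: lt_le_trans sg_lo; rewrite divr_gt0.
have sgp : 0 < sg ^+ 2 by rewrite exprn_gt0.
have sg2 : x ^+ 2 <= 16 * sg ^+ 2.
  have -> : 16 * sg ^+ 2 = (4 * sg) ^+ 2 by ring.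
  have xsg : x <= 4 * sg by clear -sg_lo; lra.
  by apply: lerXn2r => //; rewrite nnegrE; [exact: ltW | apply: le_trans xsg; exact: ltW].
have B22 : 0 < B ^+ 22 by rewrite exprn_gt0.
have H : 128 / (B ^+ 8 * (4 * B ^+ 2) ^+ 2 * sg ^+ 2) <= 128 * B ^+ 10.
  have -> : B ^+ 8 * (4 * B ^+ 2) ^+ 2 * sg ^+ 2 = 16 * B ^+ 12 * sg ^+ 2 by ring.
  have B12 : 0 < 16 * B ^+ 12 by rewrite mulr_gt0// exprn_gt0.
  rewrite ler_pdivrMr; last exact: mulr_gt0.
  have -> : 128 * B ^+ 10 * (16 * B ^+ 12 * sg ^+ 2) = 128 * (B ^+ 22 * (16 * sg ^+ 2)) by ring.
  have : B ^+ 22 * x ^+ 2 <= B ^+ 22 * (16 * sg ^+ 2) by rewrite ler_pM2l.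
  by clear -sq_lo; lra.
have B410 : B ^+ 4 <= B ^+ 10 by rewrite ler_weXn2l.
have p1p : 0 <= P * B ^+ 10 by rewrite mulr_ge0// exprn_ge0// ltW.
have -> : B ^+ 8 * (4 * B ^+ 2) = 4 * B ^+ 10 by ring.
have E : 64 * (4 * B ^+ 2) ^+ 2 = 1024 * B ^+ 4 by ring.
have C12 : 2 ^+ 12 = 4096 :> R by ring.
have B10 : 0 < B ^+ 10 by rewrite exprn_gt0.
by rewrite E C12; clear -H B410 p1p B10; lra.
Qed.

End ScaleArithmetic.

(** * Lower bound on the defect, uniform in the size of the cylinder *)

Section Transience.
Context {R : realType} (e : int -> bool) (D Q : nat).
(** Ratio of consecutive frequency scales, chosen so that [D ^ p = (2 ^ p) ^ 11]. *)
Hypothesis DE : D = (2 ^ 11)%N.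

(** [M = 8 n] keeps the frequencies of index below [n] under [pi / 4]; [K = 4 n] leaves room above
    the source for the blocks of every scale up to [Q]. *)
Let n := (D ^ Q)%N.
Let M := (8 * n)%N.
Let K := (4 * n)%N.
Let s : R := defect e M K.
(** Heights from [-K] to [K] become indices from 0 to [2 K], the source sitting at [K]. *)
Let a k i : R := hit_cos e M K k (i%:Z - K%:Z).
Let b k i : R := hit_sin e M K k (i%:Z - K%:Z).
Let theta k : R := freq M k.

Let D1 : (1 < D)%N. Proof. by rewrite DE (ltn_exp2l 0). Qed.
Let D0 : (0 < D)%N. Proof. exact: ltnW. Qed.
Let n0 : (0 < n)%N. Proof. by rewrite expn_gt0 D0. Qed.
Let M0 : (0 < M)%N. Proof. by rewrite muln_gt0. Qed.
Let K0 : (0 < K)%N. Proof. by rewrite muln_gt0. Qed.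
Let KK : (K < K + K)%N. Proof. lia. Qed.
Let np : (0 : R) < n%:R. Proof. by rewrite ltr0n. Qed.

Let a_start k : a k 0%N = 0.
Proof. by rewrite /a hit_cos_boundary//; lia. Qed.
Let a_end k : a k (K + K)%N = 0.
Proof. by rewrite /a hit_cos_boundary//; lia. Qed.
Let b_start k : b k 0%N = 0.
Proof. by rewrite /b hit_sin_boundary//; lia. Qed.
Let b_end k : b k (K + K)%N = 0.
Proof. by rewrite /b hit_sin_boundary//; lia. Qed.
Let s0 : 0 <= s.
Proof. exact: defect_ge0. Qed.

Let shiftP (i : nat) : (0 < i)%N ->
  i%:Z - K%:Z + 1 = i.+1%:Z - K%:Z /\ i%:Z - K%:Z - 1 = i.-1%:Z - K%:Z.
Proof. by move=> i0; split; lia. Qed.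

Let eqa k i : (0 < i < K + K)%N ->
  2 * a k i - a k i.+1 - a k i.-1 + (1 - cos (theta k)) * a k i =
  sin (theta k) * (orient e (i%:Z - K%:Z) * b k i) + s * (i == K)%:R.
Proof.
move=> /andP[i0 iK]; have [E1 E2] := shiftP _ i0; rewrite /a /b -E1 -E2.
have yK : (`|i%:Z - K%:Z| < K)%N by lia.
have H := @hit_cos_eq R e M K M0 k _ yK.
have -> : (i == K) = (i%:Z - K%:Z == 0) by rewrite subr_eq0 eqz_nat.
by move: H; rewrite /s /theta; lra.
Qed.

Let eqb k i : (0 < i < K + K)%N ->
  2 * b k i - b k i.+1 - b k i.-1 + (1 - cos (theta k)) * b k i =
  - sin (theta k) * (orient e (i%:Z - K%:Z) * a k i).
Proof.
move=> /andP[i0 iK]; have [E1 E2] := shiftP _ i0; rewrite /a /b -E1 -E2.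
have yK : (`|i%:Z - K%:Z| < K)%N by lia.
have H := @hit_sin_eq R e M K M0 k _ yK.
by move: H; rewrite /s /theta; lra.
Qed.

Let m0 k : 0 <= 1 - cos (theta k).
Proof. by rewrite subr_ge0 cos_le1. Qed.

Let aK k : hit_cos e M K k 0 = a k K.
Proof. by rewrite /a subrr. Qed.

(** Serves at frequency 0, where neither mass nor coupling helps. *)
Lemma hit_cos_height k : hit_cos e M K k 0 <= s * K%:R.
Proof.
rewrite aK; exact: (green_height_bound e K (K + K) (a k) (b k) _ _ _
  K0 KK (m0 k) s0 (a_start k) (a_end k) (b_start k) (b_end k) (eqa k) (eqb k)).
Qed.

(** Here [theta k = x * pi / 4] with [2 <= pi <= 4]; as the cosine lies in [0, 1], [1 - cos] is
    between half the squared sine and the squared sine. *)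
Lemma freq_estimates k (x : R) (xE : x = k%:R / n%:R) : (0 < k < n)%N ->
  [/\ x / 4 <= sin (theta k), 1 - cos (theta k) <= x ^+ 2 & x ^+ 2 / 32 <= 1 - cos (theta k)].
Proof.
move=> /andP[k0 kn].
have kp : (0 : R) < k%:R by rewrite ltr0n.
have x0 : 0 < x by rewrite xE divr_gt0.
have x1 : x <= 1 by rewrite xE ler_pdivrMr// mul1r ler_nat ltnW.
have pi0 := pi_gt0 R.
have pi2 := pi_ge2 R.
have pi4 : pi <= 4 :> R by have := @pihalf_lt2 R; lra.
have tE : theta k = x * (pi / 4).
  by rewrite /theta /freq xE /M natrM -(mulr_natr pi); field; rewrite gt_eqF.
have t0 : 0 < theta k by rewrite tE; nra.
have t1 : theta k <= pi / 4 by rewrite tE; nra.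
have [lo hi] := sin_bounds _ t0 t1.
have c0 : 0 <= cos (theta k) by apply: cos_ge0_pihalf; apply/andP; split; lra.
have c1 := cos_le1 (theta k).
have cs := cos2Dsin2 (theta k).
have lo' : x / 4 <= sin (theta k) by apply: le_trans lo; rewrite tE; nra.
have hi' : sin (theta k) <= x by apply: (le_trans hi); rewrite tE; nra.
by split => //; nra.
Qed.

Lemma hit_cos_scale p k p1 (C := 2 ^+ 12 + 32 * (2 ^+ p1) ^+ 22 : R) :
  (2 <= p1)%N -> (forall p', (p1 <= p')%N -> rich_at_scale R e p') ->
  (0 < p <= Q)%N -> (D ^ (Q - p) <= k < D ^ (Q - p).+1)%N ->
  hit_cos e M K k 0 <= s * (C * (2 ^+ p) ^+ 10).
Proof.
move=> p12 rich /andP[p0 pQ] /andP[klo khi].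
pose B : R := 2 ^+ p; rewrite -/B.
have B1 : 1 <= B by rewrite exprn_ege1// ler1n.
have B0 : 0 < B by apply: lt_le_trans B1.
have DpE : (D ^ p)%:R = B ^+ 11 :> R.
  by rewrite /B -exprM mulnC exprM natrX DE natrX.
have nE : n = (D ^ (Q - p) * D ^ p)%N by rewrite -expnD subnK.
have kn : (0 < k < n)%N.
  apply/andP; split; first by apply: leq_trans klo; rewrite expn_gt0 D0.
  by apply: (leq_trans khi); rewrite leq_exp2l// ltn_subrL p0 (leq_trans p0).
pose x : R := k%:R / n%:R.
have [sin_lo m_hi m_lo] := freq_estimates k x erefl kn.
have Dp : (0 : R) < (D ^ (Q - p))%:R by rewrite ltr0n expn_gt0 D0.
have B11 : 0 < B ^+ 11 by rewrite exprn_gt0.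
have xE : x * B ^+ 11 = k%:R / (D ^ (Q - p))%:R.
  by rewrite /x nE natrM DpE invfM -!mulrA mulVf ?mulr1// gt_eqF.
have xlo : 1 <= x * B ^+ 11 by rewrite xE ler_pdivlMr// mul1r ler_nat.
have xhi : x * B ^+ 11 <= 2 ^+ 11.
  by rewrite xE ler_pdivrMr// -natrX -DE -natrM ler_nat -expnS ltnW.
have x0 : 0 < x by rewrite -(pmulr_lgt0 _ B11); apply: lt_le_trans xlo.
(* Below [p1] nothing is known of the orientations and the mass bound is used; from [p1] on, the
   block bound. *)
rewrite aK; have [pp1|pp1] := ltnP p p1.
  have mp : 0 < 1 - cos (theta k).
    by apply: lt_le_trans m_lo; rewrite divr_gt0// exprn_gt0.
  have := green_mass_bound e K (K + K) (a k) (b k) _ _ _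
    K0 KK (m0 k) s0 (a_start k) (a_end k) (b_start k) (b_end k) (eqa k) (eqb k) mp.
  move=> /le_trans; apply; apply: ler_wpM2l => //.
  apply: scale_mass_arith m_lo _ => //.
  apply: lerXn2r; rewrite ?nnegrE ?exprn_ge0//.
  by rewrite /B ler_weXn2l ?ler1n// ltnW.
have Np : (0 < (2 ^ p) ^ 8)%N by rewrite !expn_gt0.
have qp : (0 < (2 ^ p) ^ 2)%N by rewrite !expn_gt0.
have B4 : 4 <= B.
  have -> : 4 = 2 ^+ 2 :> R by rewrite -natrX.
  by rewrite /B ler_weXn2l ?ler1n// (leq_trans p12).
have lE : (4 * (2 ^ p) ^ 2)%:R = 4 * B ^+ 2 :> R by rewrite natrM !natrX.
(* The blocks cover [4 * 2 ^ (10 p)] heights, at most [4 * D ^ p], hence at most [K]. *)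
have fit : (K + (2 ^ p) ^ 8 * (4 * (2 ^ p) ^ 2) <= K + K)%N.
  rewrite leq_add2l mulnCA leq_mul2l/= -expnD /n.
  apply: (@leq_trans (D ^ p)%N); last by rewrite leq_exp2l.
  by rewrite DE -!expnM mulnC leq_exp2l// leq_mul2r orbT.
have sg0 : sin (theta k) != 0.
  by rewrite gt_eqF//; apply: lt_le_trans sin_lo; rewrite divr_gt0.
have ml : (1 - cos (theta k)) * (4 * (2 ^ p) ^ 2)%:R ^+ 2 <= 1.
  rewrite lE; apply: le_trans (scale_fit_arith B x B4 x0 xhi).
  by rewrite ler_wpM2r// sqr_ge0.
have := green_block_bound e K (K + K) (a k) (b k) _ _ _
  K0 KK (m0 k) s0 (a_start k) (a_end k) (b_start k) (b_end k) (eqa k) (eqb k)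
  _ _ qp Np fit sg0 ml (rich p pp1).
move=> /le_trans; apply; apply: ler_wpM2l => //.
rewrite natrM lE !natrX.
by apply: scale_block_arith sin_lo _ => //; rewrite !exprn_ge0.
Qed.

(** Discrete form of the integrability of [theta ^ (- 10/11)]: the range from [D ^ J] to [D ^ J.+1]
    contributes a multiple of [D ^ J / 2 ^ (10 J) = 2 ^ J], a geometric series. *)
Lemma dyadic_sum (J : nat) : (J <= Q)%N ->
  \sum_(1 <= k < D ^ J) (2 ^+ (Q - trunc_log D k)) ^+ 10 <= (2 ^+ Q) ^+ 10 * (D%:R * 2 ^+ J) :> R.
Proof.
elim: J => [|J IH] JQ; first by rewrite big_geq// !mulr_ge0 ?exprn_ge0.
rewrite (big_cat_nat (n := (D ^ J)%N))/= ?expn_gt0 ?D0 ?leq_exp2l//.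
have H : \sum_(D ^ J <= k < D ^ J.+1) (2 ^+ (Q - trunc_log D k)) ^+ 10 <=
    (D ^ J.+1)%:R * (2 ^+ (Q - J)) ^+ 10 :> R.
  have -> : \sum_(D ^ J <= k < D ^ J.+1) (2 ^+ (Q - trunc_log D k)) ^+ 10 =
     \sum_(D ^ J <= k < D ^ J.+1) (2 ^+ (Q - J)) ^+ 10 :> R.
    by apply: eq_big_nat => k kJ; rewrite (trunc_log_eq D1 kJ).
  rewrite big_const_nat iter_addr_0 -[leLHS]mulr_natl ler_wpM2r ?exprn_ge0// ler_nat.
  exact: leq_subr.
have E : (D ^ J.+1)%:R * (2 ^+ (Q - J)) ^+ 10 = (2 ^+ Q) ^+ 10 * (D%:R * 2 ^+ J) :> R.
  rewrite -[in RHS](subnKC (ltnW JQ)) exprD natrX exprS.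
  have -> : D%:R ^+ J = (2 ^+ J) ^+ 11 :> R by rewrite DE natrX -!exprM mulnC.
  by ring.
have H0 := IH (ltnW JQ); rewrite E in H.
rewrite [2 ^+ J.+1]exprS.
have -> : (2 ^+ Q) ^+ 10 * (D%:R * (2 * 2 ^+ J)) =
  (2 ^+ Q) ^+ 10 * (D%:R * 2 ^+ J) + (2 ^+ Q) ^+ 10 * (D%:R * 2 ^+ J) :> R by ring.
exact: lerD.
Qed.

Lemma defect_lower_bound p1 (C := 2 ^+ 12 + 32 * (2 ^+ p1) ^+ 22 : R) :
  (2 <= p1)%N -> (forall p', (p1 <= p')%N -> rich_at_scale R e p') ->
  1 <= s * (8 + 2 * D%:R * C).
Proof.
move=> p12 rich.
have C0 : 0 <= C by rewrite /C addr_ge0// mulr_ge0// !exprn_ge0.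
(* The index [k] belongs to the scale [p = Q - trunc_log D k]; frequency 0 is treated apart. *)
pose beta k : R := if k == 0%N then s * K%:R else s * C * (2 ^+ (Q - trunc_log D k)) ^+ 10.
have beta0 k : 0 <= beta k.
  by rewrite /beta; case: ifP => _; rewrite !mulr_ge0// !exprn_ge0.
have Hbeta k : (k < n)%N -> hit_cos e M K k 0 <= beta k.
  rewrite /beta; case: eqP => [-> _|/eqP]; first exact: hit_cos_height.
  rewrite -lt0n => k0 kn; rewrite -mulrA.
  have /andP[lo hi] := trunc_log_bounds D1 k0.
  have tQ : (trunc_log D k < Q)%N.
    by rewrite -(ltn_exp2l _ _ D1); apply: leq_ltn_trans lo kn.
  apply: hit_cos_scale => //; first by rewrite subn_gt0 tQ leq_subr.
  by rewrite subKn ?lo ?hi// ltnW.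
have := fejer_bound e M K M0 K0 n beta n0 beta0 Hbeta.
rewrite (big_ltn n0) [beta 0%N]/beta eqxx.
have -> : \sum_(1 <= k < n) beta k = s * C * \sum_(1 <= k < n) (2 ^+ (Q - trunc_log D k)) ^+ 10.
  by rewrite mulr_sumr; apply: eq_big_nat => -[].
have := dyadic_sum Q (leqnn Q); rewrite -/n => H.
have nE : (2 ^+ Q) ^+ 10 * (D%:R * 2 ^+ Q) = D%:R * n%:R :> R.
  by rewrite /n natrX mulrCA -exprSr -exprM mulnC exprM DE natrX.
rewrite nE in H; have H1 := ler_wpM2l (mulr_ge0 s0 C0) H.
have -> : K%:R = 4 * n%:R :> R by rewrite natrM.
move=> H2; rewrite -(ler_pM2r np) mul1r; apply: (le_trans H2).
have -> : s * (8 + 2 * D%:R * C) * n%:R = 2 * (s * (4 * n%:R) + s * C * (D%:R * n%:R)) by ring.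
by rewrite ler_pM2l// lerD2l.
Qed.

End Transience.

Lemma first_hit_ge0 {R : realType} (e : int -> bool) n u : 0 <= first_hit e n u :> R.
Proof.
elim: n u => [//|n IH] u /=; rewrite mulr_ge0// ?invr_ge0//.
by apply: sumr_ge0 => w _; case: ifP => _ //; case: ifP.
Qed.

(** The lower bound on the defect does not involve [Q], so it controls all partial sums of return
    probabilities, each on a large enough cylinder. *)
Lemma transient_of_rich_scales (R : realType) (e : int -> bool) (p0 : nat) :
  (forall p, (p0 <= p)%N -> rich_at_scale R e p) -> srw_transient R e.
Proof.
(* [p1 >= 2] gives the [B >= 4] required by [scale_fit_arith]. *)
move=> rich; pose p1 := maxn p0 2.
have [D DE] : exists D : nat, D = (2 ^ 11)%N by exists (2 ^ 11)%N.
pose c : R := 8 + 2 * D%:R * (2 ^+ 12 + 32 * (2 ^+ p1) ^+ 22).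
have cp : 0 < c.
  by rewrite /c ltr_wpDr// mulr_ge0 ?mulr_ge0// addr_ge0// mulr_ge0// !exprn_ge0.
have partial n : \sum_(0 <= j < n.+2) first_hit e j (0, 0) <= 1 - c^-1 / 3 :> R.
  have D1 : (1 < D)%N by rewrite DE (ltn_exp2l 0).
  have nn : (n.+2 < D ^ n.+2)%N by exact: ltn_expl.
  have M0 : (0 < 8 * D ^ n.+2)%N by rewrite muln_gt0 expn_gt0 (ltnW D1).
  have K0 : (0 < 4 * D ^ n.+2)%N by rewrite muln_gt0 expn_gt0 (ltnW D1).
  have nK : (n.+1 < 4 * D ^ n.+2)%N.
    by apply: (@leq_trans (D ^ n.+2)%N); [exact: ltnW | rewrite leq_pmull].
  apply: (le_trans (return_le e _ _ M0 K0 _ nK)).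
  have := @defect_lower_bound R e D n.+2 DE p1 (leq_maxr _ _).
  move=> /(_ (fun p pp => rich p (leq_trans (leq_maxl _ _) pp))).
  by rewrite -/c -ler_pdivrMr// mul1r; lra.
rewrite /srw_transient; apply: (@le_lt_trans _ _ (1 - c^-1 / 3)%:E); last first.
  by rewrite lte_fin; have : 0 < c^-1 by [rewrite invr_gt0]; lra.
apply: lime_le; first by apply: is_cvg_nneseries => j _ _; rewrite lee_fin first_hit_ge0.
exists 2%N => // -[|[|n]]// _; rewrite sumEFin lee_fin; exact: partial.
Qed.

(** * Associated orientations *)

Section FiniteDimensional.
Context {d : measure_display} {T : measurableType d} {R : realType}.
Context (P : probability T R) (eps : int -> T -> bool).
Hypothesis meps : measurable_orient eps.

Definition sample {k : nat} (ys : 'I_k -> int) (w : T) : {ffun 'I_k -> bool} :=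
  [ffun i => eps (ys i) w].

Lemma cylinderE k (ys : 'I_k -> int) (x : {ffun 'I_k -> bool}) :
  [set w | forall i, eps (ys i) w = x i] = [set w | sample ys w = x].
Proof.
apply/seteqP; split => w /= H; first by apply/ffunP => i; rewrite ffunE.
by move=> i; rewrite -H ffunE.
Qed.

Lemma measurable_cylinder k (ys : 'I_k -> int) (x : {ffun 'I_k -> bool}) :
  measurable [set w | sample ys w = x].
Proof.
rewrite -cylinderE.
have -> : [set w | forall i, eps (ys i) w = x i] =
    \bigcap_(i in [set: 'I_k]) [set w | eps (ys i) w = x i].
  by apply/seteqP; split => w /= H i; [move=> _; exact: H | exact: H i I].
apply: fin_bigcap_measurable => // i _; case: (x i); first exact: meps.
have -> : [set w | eps (ys i) w = false] = ~` [set w | eps (ys i) w].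
  by apply/seteqP; split => w /=; [move=> -> | move/negP/negbTE].
by apply: measurableC; exact: meps.
Qed.

Lemma cyl_probE k (ys : 'I_k -> int) x :
  P [set w | sample ys w = x] = (cyl_prob P eps ys x)%:E.
Proof. by rewrite /cyl_prob cylinderE fineK// fin_num_measure//; exact: measurable_cylinder. Qed.

Lemma sample_in_seq k (ys : 'I_k -> int) (s : seq {ffun 'I_k -> bool}) : uniq s ->
  measurable [set w | sample ys w \in s] /\
  P [set w | sample ys w \in s] = (\sum_(x <- s) cyl_prob P eps ys x)%:E.
Proof.
elim: s => [_|x s IH /= /andP[xs us]].
  have -> : [set w | sample ys w \in [::]] = set0 by apply/seteqP; split.
  by rewrite measure0 big_nil.
have [ms Ps] := IH us.
have -> : [set w | sample ys w \in x :: s] =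
    [set w | sample ys w = x] `|` [set w | sample ys w \in s].
  apply/seteqP; split => w /=; rewrite inE; first by move=> /orP[/eqP|]; [left|right].
  by move=> [->|->]; rewrite ?eqxx ?orbT.
have mx := measurable_cylinder k ys x.
split; first exact: measurableU.
rewrite measureU//; last first.
  by apply/seteqP; split => w //= [-> xs']; rewrite xs' in xs.
rewrite big_cons EFinD; congr (_ + _)%E; [exact: cyl_probE | exact: Ps].
Qed.

Lemma sample_event k (ys : 'I_k -> int) (Q : pred {ffun 'I_k -> bool}) :
  measurable [set w | Q (sample ys w)] /\
  P [set w | Q (sample ys w)] = (\sum_(x | Q x) cyl_prob P eps ys x)%:E.
Proof.
have [m E] := sample_in_seq k ys (enum Q) (enum_uniq _).
have QE : [set w | Q (sample ys w)] = [set w | sample ys w \in enum Q].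
  by apply/seteqP; split => w /=; rewrite mem_enum.
by rewrite QE; split => //; rewrite E big_enum.
Qed.

Lemma cyl_prob_ge0 k (ys : 'I_k -> int) x : 0 <= cyl_prob P eps ys x.
Proof. exact/fine_ge0/measure_ge0. Qed.

Lemma sum_cyl_prob k (ys : 'I_k -> int) : \sum_x cyl_prob P eps ys x = 1.
Proof.
have [_] := sample_event k ys predT.
have -> : [set w | predT (sample ys w)] = setT by apply/seteqP; split.
by rewrite probability_setT => /esym [].
Qed.

Lemma cyl_prob_marginal k m (ys : 'I_k -> int) (sg : 'I_m -> 'I_k) z :
  cyl_prob P eps (fun a => ys (sg a)) z =
  \sum_(x : {ffun 'I_k -> bool} | [ffun a => x (sg a)] == z) cyl_prob P eps ys x.
Proof.
apply: EFin_inj; rewrite -cyl_probE.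
have [_ <-] := sample_event k ys (fun x : {ffun 'I_k -> bool} => [ffun a => x (sg a)] == z).
congr (P _); apply/seteqP; split => w /=.
  by move=> <-; apply/eqP/ffunP => a; rewrite !ffunE.
by move=> /eqP <-; apply/ffunP => a; rewrite !ffunE.
Qed.

(** [sg] may repeat an index, which covers the product of a sign with itself. *)
Lemma expect_fd_marginal k m (ys : 'I_k -> int) (sg : 'I_m -> 'I_k) h :
  expect_fd P eps (fun a => ys (sg a)) h =
  expect_fd P eps ys (fun x => h [ffun a => x (sg a)]).
Proof.
rewrite /expect_fd [RHS](partition_big (fun x : {ffun 'I_k -> bool} => [ffun a => x (sg a)]) predT)//=.
apply: eq_bigr => z _; rewrite cyl_prob_marginal mulr_sumr.
by apply: eq_bigr => x /eqP ->.
Qed.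

Section Expectation.
Context {k : nat} (ys : 'I_k -> int).
Let E := expect_fd P eps ys.

Lemma expect_fdD f g : E (fun x => f x + g x) = E f + E g.
Proof. by rewrite /E /expect_fd -big_split; apply: eq_bigr => x _ /=; rewrite mulrDl. Qed.

Lemma expect_fdZ c f : E (fun x => c * f x) = c * E f.
Proof. by rewrite /E /expect_fd mulr_sumr; apply: eq_bigr => x _; rewrite mulrA. Qed.

Lemma expect_fd_sum (I : Type) (s : seq I) (f : I -> _ -> R) :
  E (fun x => \sum_(i <- s) f i x) = \sum_(i <- s) E (f i).
Proof.
rewrite /E /expect_fd exchange_big; apply: eq_bigr => x _ /=.
by rewrite mulr_suml.
Qed.

Lemma expect_fd_cst c : E (fun=> c) = c.
Proof. by rewrite /E /expect_fd -mulr_sumr sum_cyl_prob mulr1. Qed.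

Lemma expect_fd_le f g : (forall x, f x <= g x) -> E f <= E g.
Proof.
by move=> fg; apply: ler_sum => x _; rewrite ler_wpM2r// cyl_prob_ge0.
Qed.

Lemma chebyshev_fd f (c : R) : 0 < c -> c <= E f ->
  (\sum_(x | f x < E f - c) cyl_prob P eps ys x) * c ^+ 2 <=
  E (fun x => f x ^+ 2) - E f ^+ 2.
Proof.
move=> c0 cE.
have -> : E (fun x => f x ^+ 2) - E f ^+ 2 = E (fun x => (f x - E f) ^+ 2).
  transitivity (E (fun x => f x ^+ 2 + ((- 2 * E f) * f x + E f ^+ 2))).
    by rewrite !expect_fdD expect_fdZ expect_fd_cst; ring.
  by congr (expect_fd _ _ _ _); apply/funext => x; ring.
rewrite mulr_suml big_mkcond; apply: ler_sum => x _.
case: ifPn => [fx|_]; last by rewrite mulr_ge0 ?sqr_ge0 ?cyl_prob_ge0.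
rewrite mulrC ler_wpM2r ?cyl_prob_ge0// -[(_ - E f) ^+ 2]sqrrN.
by apply: lerXn2r; rewrite ?nnegrE; lra.
Qed.

End Expectation.
End FiniteDimensional.

(** * First and second moments of the orientations *)

Section AssociatedOrientations.
Context {d : measure_display} {T : measurableType d} {R : realType}.
Context (P : probability T R) (eps : int -> T -> bool).
Hypothesis meps : measurable_orient eps.
Hypothesis stat : stationary_orient P eps.
Hypothesis symm : symmetric_marginal P eps.
Hypothesis asso : associated P eps.

(** Stationarity carries the symmetric marginal from height 0 to every height. *)
Lemma expect_sign k (ys : 'I_k -> int) i :
  expect_fd P eps ys (fun x => (sgnb (x i))%:~R) = 0.
Proof.
have marg : P [set w | eps (ys i) w] = (2%:R^-1)%:E.
  rewrite -symm.
  have E (y : int) : P [set w | eps y w] =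
      (cyl_prob P eps (fun _ : 'I_1 => y) [ffun => true])%:E.
    rewrite -cyl_probE//; congr (P _); apply/seteqP; split => w /=.
      by move=> ew; apply/ffunP => j; rewrite !ffunE.
    by move/ffunP/(_ ord0); rewrite !ffunE => ->.
  by rewrite !E -(stat 1 (fun=> 0) (ys i)); congr (cyl_prob _ _ _ _)%:E; apply/funext => j; rewrite add0r.
have [_] := sample_event P eps meps k ys (fun x => x i).
have -> : [set w | sample eps ys w i] = [set w | eps (ys i) w].
  by apply/seteqP; split => w /=; rewrite ffunE.
rewrite marg => -[half].
transitivity (2 * \sum_(x : {ffun 'I_k -> bool} | x i) cyl_prob P eps ys x - \sum_x cyl_prob P eps ys x).
  rewrite /expect_fd mulr_sumr [X in _ = X - _]big_mkcond -sumrB.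
  apply: eq_bigr => x _; rewrite /sgnb; case: (x i).
    by ring.
  by rewrite rmorphN1; ring.
by rewrite -half sum_cyl_prob// mulfV// subrr.
Qed.

Lemma expect_two_sign k (ys : 'I_k -> int) i j :
  expect_fd P eps ys (fun x => (sgnb (x i))%:~R * (sgnb (x j))%:~R) =
  corr P eps (ys j - ys i).
Proof.
pose sg (a : 'I_2) := if val a == 0%N then i else j.
transitivity (expect_fd P eps (fun a => ys (sg a)) (fun x => (sgnb (x ord0) * sgnb (x ord_max))%:~R)).
  rewrite [RHS]expect_fd_marginal//; congr (expect_fd _ _ _ _); apply/funext => x.
  by rewrite !ffunE /= intrM.
rewrite /corr /expect_fd; apply: eq_bigr => x _; congr (_ * _).
rewrite -[RHS](stat _ _ (ys i)); congr (cyl_prob _ _ _ _); apply/funext => a.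
by rewrite /sg; case: ifP => _; rewrite ?add0r ?subrK.
Qed.

(** Association applied to two coordinates, which are nondecreasing and centred. *)
Lemma corr_ge0 y : 0 <= corr P eps y.
Proof.
pose ys (a : 'I_2) : int := if val a == 0%N then 0 else y.
pose sgn (a : 'I_2) (x : {ffun 'I_2 -> bool}) : R := (sgnb (x a))%:~R.
have mono a : coord_nondecr (sgn a).
  move=> x x' /(_ a); rewrite /sgn ler_int /sgnb; by case: (x a); case: (x' a).
have := asso 2 ys (sgn ord0) (sgn ord_max) (mono _) (mono _).
by rewrite /cov_fd !expect_sign mul0r subr0 /sgn expect_two_sign /ys /= subr0.
Qed.

Lemma corr_le1 y : corr P eps y <= 1.
Proof.
pose ys (i : 'I_2) : int := if val i == 0%N then 0 else y.
apply: (@le_trans _ _ (expect_fd P eps ys (fun=> 1))); last by rewrite expect_fd_cst.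
apply: expect_fd_le => x; rewrite lerz1 /sgnb; by case: (x _); case: (x _).
Qed.

Lemma corr0 : corr P eps 0 = 1.
Proof.
have := expect_two_sign 1 (fun=> 0) ord0 ord0; rewrite subrr => <-.
rewrite -[RHS](expect_fd_cst P eps meps (fun=> 0 : int) 1 (k := 1)).
by congr (expect_fd _ _ _ _); apply/funext => x; rewrite /sgnb; case: (x _);
  rewrite ?mulr1// rmorphN1 mulrNN mulr1.
Qed.

(** Lets [block_sum] act on finite configurations; the values outside [0 <= y < k] are arbitrary and
    never read in the sums below. *)
Definition extend {k : nat} (x : {ffun 'I_k -> bool}) (y : int) : bool :=
  if insub `|y|%N is Some i then x i else false.

Lemma extend_nat k (x : {ffun 'I_k -> bool}) (i : nat) (ik : (i < k)%N) :
  extend x i = x (Ordinal ik).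
Proof. by rewrite /extend absz_nat insubT. Qed.

Section Segment.
Context (k : nat).
Local Notation E := (expect_fd P eps (fun i : 'I_k => (i : nat)%:Z)).

Lemma expect_orient (i : nat) : (i < k)%N -> E (fun x => orient (extend x) i) = 0.
Proof.
move=> ik; rewrite -[RHS](expect_sign k (fun i : 'I_k => (i : nat)%:Z) (Ordinal ik)).
by congr (expect_fd _ _ _ _); apply/funext => x; rewrite /orient (extend_nat _ _ _ ik).
Qed.

Lemma expect_orient2 (i j : nat) : (i < k)%N -> (j < k)%N ->
  E (fun x => orient (extend x) i * orient (extend x) j) = corr P eps (j%:Z - i%:Z).
Proof.
move=> ik jk; rewrite -(expect_two_sign k (fun i : 'I_k => (i : nat)%:Z) (Ordinal ik) (Ordinal jk)).
congr (expect_fd _ _ _ _); apply/funext => x.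
by rewrite /orient (extend_nat _ _ _ ik) (extend_nat _ _ _ jk).
Qed.

Lemma expect_linear (u : nat -> R) (i0 m : nat) : (i0 + m <= k)%N ->
  E (fun x => \sum_(0 <= i < m) orient (extend x) (i0 + i)%N * u i) = 0.
Proof.
move=> mk; rewrite expect_fd_sum big_nat big1// => i /andP[_ im].
under [X in expect_fd _ _ _ X]eq_fun do rewrite mulrC.
by rewrite expect_fdZ expect_orient ?mulr0//; lia.
Qed.

Lemma expect_linear_sqr (u : nat -> R) (i0 m : nat) : (i0 + m <= k)%N ->
  E (fun x => (\sum_(0 <= i < m) orient (extend x) (i0 + i)%N * u i) ^+ 2) =
  \sum_(0 <= i < m) \sum_(0 <= j < m) u i * u j * corr P eps (j%:Z - i%:Z).
Proof.
move=> mk.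
transitivity (E (fun x => \sum_(0 <= i < m) \sum_(0 <= j < m)
   (u i * u j) * (orient (extend x) (i0 + i)%N * orient (extend x) (i0 + j)%N))).
  congr (expect_fd _ _ _ _); apply/funext => x.
  rewrite expr2 mulr_suml; apply: eq_bigr => i _.
  by rewrite mulr_sumr; apply: eq_bigr => j _; ring.
rewrite expect_fd_sum; apply: eq_big_nat => i /andP[_ im].
rewrite expect_fd_sum; apply: eq_big_nat => j /andP[_ jm].
rewrite expect_fdZ expect_orient2; [|lia|lia]; congr (_ * corr _ _ _); lia.
Qed.

End Segment.
End AssociatedOrientations.

(** * Mean and variance of the block energy *)

Section BlockEnergyConcentration.
Context {d : measure_display} {T : measurableType d} {R : realType}.
Context (P : probability T R) (eps : int -> T -> bool).
Hypothesis meps : measurable_orient eps.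
Hypothesis stat : stationary_orient P eps.
Hypothesis symm : symmetric_marginal P eps.
Hypothesis asso : associated P eps.
Context (N q : nat).

Let l := (4 * q)%N.
Let L := (N * l)%N.
Local Notation E := (expect_fd P eps (fun i : 'I_L => (i : nat)%:Z)).
Local Notation config := {ffun 'I_L -> bool}.

Let W (j : nat) (x : config) : R := block_sum (extend x) l j.
Let U (x : config) : R := \sum_(0 <= j < N) W j x.
Let V (x : config) : R := block_energy (extend x) N l.

(** Correlations being nonnegative, the diagonal suffices; on the middle half of the block, [2 q]
    heights, the tent is at least [q]. *)
Lemma expect_block_sqr j : (j < N)%N -> 2 * q%:R ^+ 3 <= E (fun x => W j x ^+ 2).
Proof.
move=> jN; have fit : (j * l + l <= L)%N by rewrite -mulSnr leq_mul2r jN orbT.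
rewrite [leRHS](expect_linear_sqr P eps meps stat L (tent l) (j * l)%N l fit).
have F0 i h : 0 <= tent l i * tent l h * corr P eps (h%:Z - i%:Z).
  by rewrite !mulr_ge0 ?tent_ge0//; exact: corr_ge0.
have diag i : (i < l)%N -> tent l i ^+ 2 <=
    \sum_(0 <= h < l) tent l i * tent l h * corr P eps (h%:Z - i%:Z).
  move=> il; have il1 : (i + 1 <= l)%N by rewrite addn1.
  apply: le_trans (sum_translate_le l i 1 _ (F0 i) il1).
  by rewrite big_nat1 addn0 subrr corr0// mulr1 expr2.
apply: (@le_trans _ _ (\sum_(0 <= i < l) tent l i ^+ 2)); last first.
  by apply: ler_sum_nat => i /andP[_ il]; exact: diag.
have ql : (q + 2 * q <= l)%N by rewrite /l; lia.
apply: le_trans (sum_translate_le l q (2 * q) _ (fun i => sqr_ge0 (tent l i)) ql).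
have -> : 2 * q%:R ^+ 3 = \sum_(0 <= i < 2 * q) q%:R ^+ 2 :> R.
  by rewrite big_const_nat iter_addr_0 subn0 -[RHS]mulr_natl natrM; ring.
apply: ler_sum_nat => i /andP[_ iq]; apply: lerXn2r; rewrite ?nnegrE ?ler0n//.
by rewrite /tent ler_nat /l; lia.
Qed.

Lemma expect_energy_ge : 2 * (N%:R * q%:R ^+ 3) <= E V.
Proof.
rewrite /V /block_energy expect_fd_sum.
have -> : 2 * (N%:R * q%:R ^+ 3) = \sum_(0 <= j < N) 2 * q%:R ^+ 3 :> R.
  by rewrite big_const_nat iter_addr_0 subn0 -[RHS]mulr_natl; ring.
by apply: ler_sum_nat => j /andP[_ jN]; exact: expect_block_sqr.
Qed.

Let u (i : nat) : R := tent l (i %% l).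

Let UE x : U x = \sum_(0 <= i < L) orient (extend x) (0 + i)%N * u i.
Proof.
rewrite sum_nat_blocks /U; apply: eq_bigr => j _.
by apply: eq_big_nat => r /andP[_ rl]; rewrite /u modnMDl modn_small.
Qed.

Lemma expect_total : E U = 0.
Proof.
have -> : U = (fun x => \sum_(0 <= i < L) orient (extend x) (0 + i)%N * u i).
  by apply/funext => x; exact: UE.
by apply: expect_linear.
Qed.

(** Tents are at most [l], and each of the [L] rows of the correlation matrix sums to at most twice
    the sum of [rho]. *)
Lemma expect_total_sqr (rho : nat -> R) : (forall k, 0 <= rho k) ->
  (forall y, corr P eps y <= rho `|y|%N) ->
  E (fun x => U x ^+ 2) <= l%:R ^+ 2 * (L%:R * (2 * \sum_(0 <= k < L) rho k)).
Proof.
move=> rho0 Hrho.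
have -> : (fun x => U x ^+ 2) = (fun x => (\sum_(0 <= i < L) orient (extend x) (0 + i)%N * u i) ^+ 2).
  by apply/funext => x; rewrite UE.
rewrite (expect_linear_sqr P eps meps stat L u 0 L)//.
have -> : l%:R ^+ 2 * (L%:R * (2 * \sum_(0 <= k < L) rho k)) =
    \sum_(0 <= i < L) l%:R ^+ 2 * (2 * \sum_(0 <= k < L) rho k).
  by rewrite big_const_nat iter_addr_0 subn0 -[RHS]mulr_natl; ring.
apply: ler_sum_nat => i /andP[_ iL].
apply: le_trans (ler_wpM2l (sqr_ge0 _) (sum_dist_le L rho i rho0 iL)).
rewrite mulr_sumr; apply: ler_sum => j _.
apply: ler_pM; [by rewrite mulr_ge0 ?tent_ge0 | exact: corr_ge0 | |].
  by rewrite expr2; apply: ler_pM; rewrite ?tent_ge0 ?tent_le.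
by apply: (le_trans (Hrho _)); rewrite distnC.
Qed.

Let block_sum_mono j (x x' : config) : (forall i, x i ==> x' i) -> W j x <= W j x'.
Proof.
move=> xx'; apply: ler_sum => r _; rewrite ler_wpM2r ?tent_ge0// ler_int /extend.
case: insubP => [i _ _|_]; last by [].
by have := xx' i; rewrite /sgnb; case: (x i); case: (x' i).
Qed.

Let block_sum_bound j (x : config) : `|W j x| <= l%:R ^+ 2.
Proof.
apply: (le_trans (ler_norm_sum _ _ _)).
have -> : l%:R ^+ 2 = \sum_(0 <= r < l) l%:R :> R.
  by rewrite big_const_nat iter_addr_0 subn0 -[RHS]mulr_natl expr2.
apply: ler_sum => r _; rewrite normrM (ger0_norm (tent_ge0 _ _)).
suff -> : `|orient (extend x) (j * l + r)%N| = 1 :> R by rewrite mul1r tent_le.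
by rewrite /orient /sgnb; case: (extend _ _); rewrite ?normr1// rmorphN1 normrN1.
Qed.

(* Since |W j| <= l^2, both 2 l^2 U + V and 2 l^2 U - V are coordinatewise
   nondecreasing: association bounds the variance of V by that of 2 l^2 U. *)
Lemma variance_energy_le :
  E (fun x => V x ^+ 2) - E V ^+ 2 <= 4 * l%:R ^+ 4 * E (fun x => U x ^+ 2).
Proof.
pose w : R := l%:R ^+ 2.
have mono (c : R) : `|c| <= 1 -> coord_nondecr (fun x : config => 2 * w * U x + c * V x).
  rewrite ler_norml => /andP[c1 c2] x x' xx'; rewrite /U /V /block_energy !mulr_sumr -!big_split.
  apply: ler_sum => j _; rewrite /= -/(W j x) -/(W j x').
  have M := block_sum_mono j _ _ xx'.
  have := block_sum_bound j x; have := block_sum_bound j x'.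
  rewrite -/w !ler_norml => /andP[a1 a2] /andP[b1 b2].
  rewrite -subr_ge0.
  (* The last factor is nonnegative because both block sums are at most [w] in absolute value. *)
  have -> : 2 * w * W j x' + c * W j x' ^+ 2 - (2 * w * W j x + c * W j x ^+ 2) =
    (W j x' - W j x) * (2 * w + c * (W j x' + W j x)) by ring.
  apply: mulr_ge0; first by rewrite subr_ge0.
  nra.
have m1 := mono 1; have m2 := mono (-1); rewrite normr1 in m1; rewrite normrN1 in m2.
(* As [U] is centred, this covariance is [4 * w ^ 2] times the variance of [U] minus the variance of
   [V]. *)
have := asso L (fun i : 'I_L => (i : nat)%:Z) _ _ (m1 (lexx _)) (m2 (lexx _)).
rewrite /cov_fd !expect_fdD !expect_fdZ expect_total.
have -> : E (fun x => (2 * w * U x + 1 * V x) * (2 * w * U x + - 1 * V x)) =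
    4 * l%:R ^+ 4 * E (fun x => U x ^+ 2) + - 1 * E (fun x => V x ^+ 2).
  rewrite -!expect_fdZ -expect_fdD; congr (expect_fd _ _ _ _).
  by apply/funext => x; rewrite /w; ring.
lra.
Qed.

Lemma poor_scale_prob (rho : nat -> R) (c := N%:R * q%:R ^+ 3 : R) : (0 < N)%N -> (0 < q)%N ->
  (forall k, 0 <= rho k) -> (forall y, corr P eps y <= rho `|y|%N) ->
  measurable [set w | block_energy (eps ^~ w) N l < c] /\
  (P [set w | (block_energy (eps ^~ w) N l < c)%R] <=
  (4 * l%:R ^+ 4 * (l%:R ^+ 2 * (L%:R * (2 * \sum_(0 <= k < L) rho k))) / c ^+ 2)%:E)%E.
Proof.
move=> N0 q0 rho0 Hrho.
have c0 : 0 < c by rewrite mulr_gt0 ?exprn_gt0 ?ltr0n.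
have [mS PS] := sample_event P eps meps L (fun i : 'I_L => (i : nat)%:Z) (fun x => V x < c).
have SE : [set w | block_energy (eps ^~ w) N l < c] =
    [set w | V (sample eps (fun i : 'I_L => (i : nat)%:Z) w) < c].
  have BE w : block_energy (eps ^~ w) N l = V (sample eps (fun i : 'I_L => (i : nat)%:Z) w).
    apply: eq_big_nat => j /andP[_ jN]; congr (_ ^+ _).
    apply: eq_big_nat => r /andP[_ rl]; congr (_ * _).
    have H : (j * l + r < L)%N by rewrite /L; nia.
    by rewrite /orient (extend_nat _ _ _ H) ffunE.
  by apply/seteqP; split => w /=; rewrite BE.
rewrite SE; split => //; rewrite PS lee_fin ler_pdivlMr ?exprn_gt0//.
have EV := expect_energy_ge; rewrite -/c in EV.
(* The mean is at least [2 * c], so [V < c] is a deviation by at least [c]. *)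
have cE : c <= E V by lra.
apply: le_trans (le_trans variance_energy_le (ler_wpM2l _ (expect_total_sqr rho rho0 Hrho))); last first.
  by rewrite mulr_ge0// exprn_ge0.
apply: le_trans (chebyshev_fd P eps meps _ V c c0 cE).
rewrite ler_wpM2r ?sqr_ge0// [leLHS]big_mkcond [leRHS]big_mkcond.
apply: ler_sum => x _; case: ifP => Vx; last by case: ifP => // _; exact: cyl_prob_ge0.
by rewrite ifT//; lra.
Qed.

End BlockEnergyConcentration.

(** * Poor scales and the Borel-Cantelli argument *)

(** With [B = 2 ^ p], the variance bound is of order [B ^ 27] and the squared threshold is [B ^ 28],
    leaving the summable factor [1 / B]. *)
Lemma poor_scale_summable {d : measure_display} {T : measurableType d} {R : realType}
  (P : probability T R) (eps : int -> T -> bool) (C : R) (Y p : nat) :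
  measurable_orient eps -> stationary_orient P eps -> symmetric_marginal P eps ->
  associated P eps -> 0 <= C ->
  (forall y : int, (Y <= `|y|)%N -> (0 < `|y|)%N -> corr P eps y <= C / `|y|%:R) ->
  (Y <= p)%N ->
  measurable [set w | ~ rich_at_scale R (eps ^~ w) p] /\
  (P [set w | ~ rich_at_scale R (eps ^~ w) p] <= (2 ^+ 17 * (1 + 4 * C) / 2 ^+ p)%:E)%E.
Proof.
move=> meps stat symm asso C0 decay Yp.
have -> : [set w | ~ rich_at_scale R (eps ^~ w) p] = [set w |
    block_energy (eps ^~ w) ((2 ^ p) ^ 8) (4 * (2 ^ p) ^ 2) < ((2 ^ p) ^ 8)%:R * ((2 ^ p) ^ 2)%:R ^+ 3 :> R].
  by apply/seteqP; split => w /=; rewrite /rich_at_scale ltNge => /negP.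
(* Cutoff [A = B ^ 5]: correlations are bounded by 1 below it and by [C / A] above. As
   [L = 4 * B ^ 10], both ranges contribute order [B ^ 5]. *)
pose A := ((2 ^ p) ^ 5)%N.
have A0 : (0 < A)%N by rewrite !expn_gt0.
have Ap : (0 : R) < A%:R by rewrite ltr0n.
have YA : (Y <= A)%N.
  apply: (leq_trans Yp); apply: (@leq_trans (2 ^ p)%N); first exact/ltnW/ltn_expl.
  by rewrite -[X in (X <= _)%N]expn1 leq_pexp2l// expn_gt0.
pose rho k : R := if (k < A)%N then 1 else C / A%:R.
have CA : 0 <= C / A%:R by rewrite divr_ge0// ltW.
have rho0 k : 0 <= rho k by rewrite /rho; case: ifP.
have Hrho y : corr P eps y <= rho `|y|%N.
  rewrite /rho; case: ltnP => yA; first exact: corr_le1.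
  apply: le_trans (decay y (leq_trans YA yA) (leq_trans A0 yA)) _.
  by rewrite ler_wpM2l// lef_pV2 ?posrE ?ltr0n ?(leq_trans A0)// ler_nat.
have [Np qp] : (0 < (2 ^ p) ^ 8)%N /\ (0 < (2 ^ p) ^ 2)%N by rewrite !expn_gt0.
have [mB PB] := poor_scale_prob P eps meps stat symm asso _ _ rho Np qp rho0 Hrho.
split => //; apply: (le_trans PB); rewrite lee_fin.
set L := ((2 ^ p) ^ 8 * (4 * (2 ^ p) ^ 2))%N.
have Srho : \sum_(0 <= k < L) rho k <= A%:R + L%:R * (C / A%:R).
  have AL : (A <= L)%N.
    rewrite /L mulnCA -expnD; apply: leq_trans (leq_pmull _ _) => //.
    by rewrite leq_pexp2l// expn_gt0.
  rewrite (big_cat_nat (leq0n A) AL)/=; apply: lerD.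
    rewrite (eq_big_nat _ _ (F2 := fun=> 1)); last by move=> k /andP[_ kA]; rewrite /rho kA.
    by rewrite big_const_nat iter_addr_0 subn0.
  rewrite (eq_big_nat _ _ (F2 := fun=> C / A%:R)); last first.
    by move=> k /andP[Ak _]; rewrite /rho ltnNge Ak.
  rewrite big_const_nat iter_addr_0 -[leLHS]mulr_natl ler_wpM2r// ler_nat.
  exact: leq_subr.
pose B : R := 2 ^+ p.
have B0 : 0 < B by rewrite exprn_gt0.
have AE : A%:R = B ^+ 5 :> R by rewrite !natrX.
have lE : (4 * (2 ^ p) ^ 2)%:R = 4 * B ^+ 2 :> R by rewrite natrM !natrX.
have LE : L%:R = 4 * B ^+ 10 :> R by rewrite natrM lE !natrX -/B; ring.
rewrite lE LE !natrX -/B; rewrite AE LE in Srho.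
have BN : B != 0 by rewrite gt_eqF.
have Srho' : \sum_(0 <= k < L) rho k <= B ^+ 5 * (1 + 4 * C).
  apply: (le_trans Srho).
  by have -> : B ^+ 5 + 4 * B ^+ 10 * (C / B ^+ 5) = B ^+ 5 * (1 + 4 * C) by field.
rewrite ler_pdivrMr; last by rewrite exprn_gt0// mulr_gt0// !exprn_gt0.
have -> : 2 ^+ 17 * (1 + 4 * C) / B * (B ^+ 8 * (B ^+ 2) ^+ 3) ^+ 2 =
    4 * (4 * B ^+ 2) ^+ 4 * ((4 * B ^+ 2) ^+ 2 * (4 * B ^+ 10 * (2 * (B ^+ 5 * (1 + 4 * C))))).
  by field.
have Bge n : 0 <= B ^+ n by exact/exprn_ge0/ltW.
have l0 : 0 <= 4 * B ^+ 2 by exact: mulr_ge0.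
apply: ler_wpM2l; first by apply: mulr_ge0 => //; exact: exprn_ge0.
apply: ler_wpM2l; first exact: exprn_ge0.
apply: ler_wpM2l; first exact: mulr_ge0.
by rewrite ler_pM2l.
Qed.

Theorem theorem2p2 (d : measure_display) (T : measurableType d) (R : realType)
  (P : probability T R) (eps : int -> T -> bool) :
  measurable_orient eps ->
  stationary_orient P eps ->
  symmetric_marginal P eps ->
  associated P eps ->
  summable_power_decay P eps ->
  {ae P, forall w, srw_transient R (fun y => eps y w)}.
Proof.
move=> meps stat symm asso [alpha [alpha1 [C [Y decay]]]].
have decay1 (y : int) : (Y <= `|y|)%N -> (0 < `|y|)%N -> corr P eps y <= `|C| / `|y|%:R.
  move=> Yy y0; apply: le_trans (ler_norm _) _; apply: (le_trans (decay y Yy)).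
  have yp : (0 : R) < `|y|%:R by rewrite ltr0n.
  have H : `|y|%:R `^ (- alpha) <= (`|y|%:R : R)^-1.
    rewrite -[leRHS]powR_inv1; last exact: ltW.
    by apply: ler_powR; [rewrite ler1n | lra].
  apply: le_trans (ler_wpM2l (normr_ge0 C) H).
  by rewrite ler_wpM2r ?powR_ge0// ler_norm.
pose K : R := 2 ^+ 17 * (1 + 4 * `|C|).
have K0 : 0 <= K by rewrite mulr_ge0 ?exprn_ge0// addr_ge0// mulr_ge0.
(* The shift by [Y] puts all these scales where the decay estimate applies. *)
pose F p := [set w | ~ rich_at_scale R (eps ^~ w) (p + Y)].
have FP p := poor_scale_summable P eps `|C| Y (p + Y) meps stat symm asso (normr_ge0 C) decay1 (leq_addl p Y).
have lim0 : P (lim_sup_set F) = 0%E.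
  apply: lim_sup_set_cvg0 => [p|]; first by have [] := FP p.
  have K20 : 0 <= K * 2 by exact: mulr_ge0.
  (* Comparison with the geometric series of terms [K * 2 / 2 ^ p.+1]. *)
  apply: le_lt_trans (ltry (K * 2)); apply: le_trans (epsilon_trick0 xpredT K20).
  apply: lee_nneseries => [p _ _|p _]; first exact: measure_ge0.
  have [_ /le_trans] := FP p; apply; rewrite lee_fin -/K.
  have -> : K * 2 / (2 ^ p.+1)%:R = K / 2 ^+ p.
    by rewrite natrX exprS; field; rewrite gt_eqF ?exprn_gt0.
  by rewrite ler_wpM2l// lef_pV2 ?posrE ?exprn_gt0// ler_weXn2l ?ler1n// leq_addr.
exists (lim_sup_set F); split => //.
  apply: bigcapT_measurable => n; apply: bigcup_measurable => p _.
  by have [] := FP p.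
(* By contraposition: if no scale from [p + Y] on is poor, the walk is transient; hence a
   non-transient [w] has poor scales beyond every [p]. *)
move=> w /= nt p _ /=; apply: contrapT => nF; apply: nt.
apply: (transient_of_rich_scales R _ (p + Y)) => k pk.
apply: contrapT => nr; apply: nF; exists (k - Y)%N => /=; first lia.
by rewrite /F /= subnK//; lia.
Qed.
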